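(* Let $\{Z_n\}_{n\ge 0}$ be a time-inhomogeneous branching process with offspring variables $\{X_n\}_{n\ge 0}$, and let $m_n$, $\Gamma_n$ and $\zeta_n$ be as defined in the context. Assume: (i) $\sup_{n\ge 0}P(X_n=0)<1$; (ii) $\limsup_{n\to\infty}\left[P(X_n=0)+P(X_n=1)\right]<1$; (iii) $\liminf_{n\to\infty}P(X_n=0)>0$; (iv) $\Gamma_n\to\infty$ as $n\to\infty$; (v) $m_n\Gamma_n\to\infty$ as $n\to\infty$. (a) If in addition $\sup_{n\ge 0}E(X_n^r)<\infty$ for $r=1,2,3$, then $\zeta_n/E(\zeta_n)$ converges in distribution, as $n\to\infty$, to an exponential random variable with parameter $1$. (b) If in addition $\sup_{n\ge 0}E(X_n^r)<\infty$ for every integer $r\ge 1$, then $\zeta_n/E(\zeta_n)$ converges in moments to an exponential random variable with parameter $1$, i.e. for every integer $r\ge 1$, $E\left((\zeta_n/E(\zeta_n))^r\right)\to r!$ as $n\to\infty$.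
   Context: Let $X_0,X_1,X_2,\dots$ be random variables with values in $\{0,1,2,\dots\}$ (the offspring distributions). The time-inhomogeneous branching process is defined by $Z_0=1$ and $Z_{n+1}=\sum_{j=1}^{Z_n}X_{n,j}$, where all the $X_{n,j}$ ($n\ge 0$, $j\ge 1$) are independent and $X_{n,j}$ has the same distribution as $X_n$ (empty sums are $0$). Notation: $g_n(s)=E(s^{X_n})$ for $s\in[0,1]$, so $g_n''(1)=E(X_n(X_n-1))$; $\mu_n=E(X_n)=g_n'(1)$; $m_n=E(Z_n)=\prod_{i=0}^{n-1}\mu_i$; and $$\Gamma_n=\sum_{j=0}^{n-1}\frac{g_j''(1)}{2\mu_j m_{j+1}}.$$ $\zeta_n$ denotes $Z_n$ conditioned on non-extinction, i.e. a random variable whose law is the conditional law of $Z_n$ given $\{Z_n\ne 0\}$; thus $E(\zeta_n)=E(Z_n\mid Z_n\neq 0)$. *)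

(* Defs.v *)
From HB Require Import structures.
From mathcomp Require Import all_boot all_order all_algebra.
From mathcomp Require Import all_classical all_reals all_analysis.

Set Implicit Arguments.
Unset Strict Implicit.
Unset Printing Implicit Defensive.

Import Order.TTheory GRing.Theory Num.Theory.
Import numFieldNormedType.Exports.

Local Open Scope classical_set_scope.
Local Open Scope ring_scope.
Local Open Scope ereal_scope.

Definition mutually_independent (d d' : measure_display) (T : measurableType d)
    (T' : measurableType d') (R : realType) (P : probability T R)
    (I : choiceType) (X : I -> {RV P >-> T'}) : Prop :=
  forall (s : seq I) (B : I -> set T'), uniq s ->
    (forall i, measurable (B i)) ->
    P (\bigcap_(i in [set` s]) X i @^-1` B i) =
    \prod_(i <- s) P (X i @^-1` B i).

Definition same_distribution (d1 d2 d' : measure_display)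
    (T1 : measurableType d1) (T2 : measurableType d2) (T' : measurableType d')
    (R : realType) (P1 : probability T1 R) (P2 : probability T2 R)
    (X1 : {RV P1 >-> T'}) (X2 : {RV P2 >-> T'}) : Prop :=
  forall A : set T', measurable A ->
    distribution P1 X1 A = distribution P2 X2 A.

(* The j-th individual of generation n has [xi n j] children; individuals are
   numbered from 0, so X_{n,j} (j >= 1) is [xi n j.-1]. *)
Fixpoint branching (T : Type) (xi : nat -> nat -> T -> nat) (n : nat) (w : T)
    : nat :=
  if n is k.+1 then (\sum_(j < branching xi k w) xi k j w)%N else 1%N.

Definition cond_prob (d : measure_display) (T : measurableType d)
    (R : realType) (P : probability T R) (A B : set T) : \bar R :=
  P (A `&` B) / P B.

Definition moment (d : measure_display) (T : measurableType d) (R : realType)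
    (P : probability T R) (X : T -> R) (r : nat) : \bar R :=
  'E_P[fun w => (X w ^+ r)%R].

(* [fine] sends an infinite expectation to 0, so the real-valued quantities
   below are meaningful when the expectations involved are finite. *)
Definition mean_nat (d : measure_display) (T : measurableType d) (R : realType)
    (P : probability T R) (X : T -> nat) : R :=
  fine 'E_P[fun w => (X w)%:R%R].

(* g''(1) = E(X (X - 1)) for the generating function g(s) = E(s^X) of X. *)
Definition fact_moment2 (d : measure_display) (T : measurableType d)
    (R : realType) (P : probability T R) (X : T -> nat) : R :=
  fine 'E_P[fun w => ((X w)%:R * ((X w)%:R - 1))%R].

(* [X j] has the j-th offspring distribution and [m n] stands for E(Z_n). *)
Definition Gamma (d : measure_display) (T : measurableType d) (R : realType)
    (P : probability T R) (X : nat -> T -> nat) (m : nat -> R) (n : nat) : R :=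
  (\sum_(j < n) fact_moment2 P (X j) / (2 * mean_nat P (X j) * m j.+1))%R.

Definition scaled (T : Type) (R : realType) (X : T -> nat) (c : R) (w : T) : R :=
  ((X w)%:R / c)%R.

Section scaled_rv.
Context (d : measure_display) (T : measurableType d) (R : realType).
Variables (P : probability T R) (X : {RV P >-> nat}) (c : R).

Let measurable_scaled : measurable_fun [set: T] (scaled X c).
Proof.
have mf : measurable_fun [set: nat] (fun k : nat => (k%:R / c)%R : R) by [].
exact: (measurableT_comp mf (@measurable_funPT _ _ _ _ X)).
Qed.

HB.instance Definition _ :=
  isMeasurableFun.Build _ _ T R (scaled X c) measurable_scaled.

Definition scaled_rv : {RV P >-> R} := scaled X c.
End scaled_rv.

(* The random variables may live on different probability spaces; the limit is
   given by its law [mu]. *)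
Definition cvg_in_distribution (d : nat -> measure_display)
    (T : forall n, measurableType (d n)) (R : realType)
    (P : forall n, probability (T n) R) (Y : forall n, {RV (P n) >-> R})
    (mu : set R -> \bar R) : Prop :=
  forall x : R, {for x, continuous (fun y : R => mu `]-oo, y]%classic)} ->
    cdf (Y n) x @[n --> \oo] --> mu `]-oo, x]%classic.

(* Main.v *)
(* Let g_n be the generating function of X_n, f_n = g_0 o .. o g_(n-1) that of
   Z_n, and fix u_n = s, u_j = g_j(u_(j+1)), so that f_n(s) = u_0.  Then
     1 / (1 - u_0) = 1 / (m_n (1 - s)) + sum_(j < n) shape_j(u_(j+1)) / m_j,
   where shape_j(1) / m_j is the j-th term of Gamma_n and shape_j is Lipschitz
   at 1.  Since 1 - u_(j+1) is at most 1 / m_(j+1) divided by a multiple of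
   1 / m_(j+1) + .. + 1 / m_n, replacing all the u_(j+1) by 1 costs an error
   o(Gamma_n), uniformly in s.  Taking s = 0 gives P(Z_n <> 0) ~ 1 / Gamma_n;
   taking s = exp(- k / E(zeta_n)) gives E(exp(- k zeta_n / E(zeta_n))) ->
   1 / (k + 1) for each natural number k, the moments of the uniform law on [0, 1].
   A Bernstein polynomial argument turns this into (a).

   For (b), the binomial moments D_r(n) = E(binomial(Z_n, r)) satisfy
     D_r(n+1) = sum_(l <= r) [u^r] (g_n(1 + u) - 1)^l D_l(n),
   so that w_r = D_r / m_n^r increases by about (r - 1) (Gamma_(n+1) - Gamma_n)
   w_(r-1)(n), and the Stolz-Cesaro theorem gives w_r ~ Gamma_n^(r-1) by
   induction on r. *)

Require Import Defs.
From mathcomp Require Import all_boot all_order all_algebra.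
From mathcomp Require Import all_classical all_reals all_analysis.
From mathcomp Require Import measurable_realfun ring lra.

Set Implicit Arguments.
Unset Strict Implicit.
Unset Printing Implicit Defensive.

Import Order.TTheory GRing.Theory Num.Theory.
Import numFieldNormedType.Exports.

Local Open Scope classical_set_scope.
Local Open Scope ring_scope.

(** * Reciprocals of iterated generating functions *)

(** The obstacle is that nothing makes [m n] monotone or bounded, and that u_j may be far from 1
    when j is near n, in particular for s = 0; the shape functions can be compared with their values
    at 1 only on average, with weights 1 / m_j. Put a_j = 1 / m_(j+1). The bound on 1 - u_(j+1)
    makes the error at j of order a_j^2 / (a_j + .. + a_(n-1)), and these errors add up to at most a
    multiple of the square root of (max a) (sum a). By (ii) the late terms of Gamma_n are at least a
    multiple of 1 / m_j, which with (v) makes the sum O(Gamma_n); (v) makes the maximum o(Gamma_n).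
    Uniformity in s is needed because the argument exp(- k / E(zeta_n)) moves with n. Integers k
    suffice because exp(- zeta_n / E(zeta_n)) lies in [0, 1], where moments determine a law. In (b),
    powers of Z_n are expanded in binomial coefficients. Each step below the top order costs a
    factor 1 / (m_n Gamma_n), so in the limit only the top coefficient r! is left. *)

(* With tails D_i = b_i + .. + b_(n-1), each term is at most
   2 sqrt A (sqrt D_i - sqrt D_(i+1)), and these bounds telescope. *)
Lemma sum_sqr_div_tail (R : rcfType) (n : nat) (b : nat -> R) (A : R) :
  (forall k, 0 < b k) -> (forall k, (k < n)%N -> b k <= A) ->
  \sum_(0 <= i < n) b i ^+ 2 / (\sum_(i <= k < n) b k) <=
    2 * Num.sqrt A * Num.sqrt (\sum_(0 <= k < n) b k).
Proof.
elim: n b => [|n IH] b b_gt0 b_leA.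
  by rewrite big_geq// !mulr_ge0 ?sqrtr_ge0.
have leT := IH (fun k => b k.+1) (fun k => b_gt0 k.+1) (fun k kn => b_leA k.+1 kn).
rewrite big_nat_recl//=.
under [X in _ + X <= _]eq_bigr => i _ do rewrite big_add1/=.
rewrite (big_nat_recl n 0 b)//.
set T := \sum_(0 <= i < n) _ / _ in leT *; set D1 := \sum_(0 <= k < n) b k.+1 in leT *.
have D1_ge0 : 0 <= D1 by apply: sumr_ge0 => i _; exact: ltW.
have b0 := b_gt0 0%N; have b0A := b_leA 0%N isT.
have A0 : 0 <= A by lra.
set x := Num.sqrt (b 0%N + D1); set y := Num.sqrt D1 in leT.
have x_gt0 : 0 < x by rewrite sqrtr_gt0; lra.
have y_ge0 : 0 <= y by exact: sqrtr_ge0.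
have xE : x ^+ 2 = b 0%N + D1 by rewrite sqr_sqrtr//; lra.
have yE : y ^+ 2 = D1 by rewrite sqr_sqrtr.
have yx : y <= x by rewrite ler_wsqrtr//; lra.
set a := Num.sqrt A in leT *.
have a_ge0 : 0 <= a by exact: sqrtr_ge0.
have aE : a ^+ 2 = A by rewrite sqr_sqrtr.
have bax : b 0%N <= a * x.
  rewrite -(@ler_pXn2r _ 2)// ?nnegrE ?mulr_ge0 ?(ltW b0) ?(ltW x_gt0)// exprMn aE xE.
  by rewrite expr2; apply: ler_pM => //; lra.
(* One factor b_0 is at most 2 x (x - y), being a difference of squares; the other is at most a x,
   because b_0 <= A and b_0 <= x^2. The resulting x^2 is the denominator. *)
suff : b 0%N ^+ 2 / (b 0%N + D1) <= 2 * a * (x - y) by lra.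
rewrite -xE ler_pdivrMr ?exprn_gt0//.
have b2 : b 0%N <= 2 * x * (x - y).
  have -> : b 0%N = (x - y) * (x + y) by rewrite -subr_sqr xE yE; ring.
  by rewrite [leRHS]mulrC ler_wpM2l//; lra.
rewrite expr2; apply: (@le_trans _ _ (2 * x * (x - y) * (a * x))).
  by apply: ler_pM => //; lra.
by rewrite le_eqVlt; apply/orP; left; apply/eqP; ring.
Qed.

Section reciprocal.
Context (R : realType).
(** [q n] and [beta n] stand for the first and second difference quotients of [g n] at 1, with
    limits [mu n] and [b n / 2] there. [delta] and [eps] come from lower bounds on P(X_n > 0) and,
    from [N0] on, on P(X_n > 1); [M] bounds both the means and the third-order remainders. *)
Variables (g q beta : nat -> R -> R) (mu b m : nat -> R) (delta eps M : R) (N0 : nat).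
Hypothesis delta_gt0 : 0 < delta.
Hypothesis eps_gt0 : 0 < eps.
Hypothesis muM : forall n, mu n <= M.
Hypothesis qE : forall n (s : R), 0 <= s < 1 -> 1 - g n s = (1 - s) * q n s :> R.
Hypothesis q_bounds : forall n (s : R), 0 <= s < 1 -> delta <= q n s <= mu n.
Hypothesis betaE : forall n (s : R), 0 <= s < 1 -> mu n - q n s = (1 - s) * beta n s :> R.
Hypothesis beta_ge0 : forall n (s : R), 0 <= s < 1 -> 0 <= beta n s.
Hypothesis beta_b : forall n (s : R), 0 <= s < 1 -> 0 <= b n / 2 - beta n s <= M * (1 - s).
Hypothesis beta_eps : forall n (s : R), (N0 <= n)%N -> 0 <= s < 1 -> eps <= beta n s.
Hypothesis m0 : m 0%N = 1 :> R.
Hypothesis mS : forall n, m n.+1 = m n * mu n :> R.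
Hypothesis g_ge0 : forall n (s : R), 0 <= s < 1 -> 0 <= g n s.

Let G n := \sum_(j < n) b j / (2 * mu j * m j.+1).

Hypothesis G_infty : G n @[n --> \oo] --> +oo.
Hypothesis mG_infty : (m n * G n) @[n --> \oo] --> +oo.

Let I0 : 0 <= (0 : R) < 1. Proof. by rewrite lexx ltr01. Qed.

Lemma mean_ge_delta n : delta <= mu n.
Proof. by have /andP[] := q_bounds n I0; exact: le_trans. Qed.

Let mu_gt0 n : 0 < mu n.
Proof. exact: lt_le_trans (mean_ge_delta n). Qed.

Let M_gt0 : 0 < M. Proof. exact: lt_le_trans (muM 0). Qed.

Lemma means_gt0 n : 0 < m n.
Proof. by elim: n => [|n IH]; rewrite ?m0// mS mulr_gt0. Qed.

Lemma fact_moment_ge0 n : 0 <= b n.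
Proof.
have := beta_b n I0; have := beta_ge0 n I0; lra.
Qed.

(** At s = 0, [beta n 0] is at most [mu n], and [b n / 2] exceeds it by at most M. *)
Lemma fact_moment_le n : b n <= 4 * M.
Proof.
have /andP[_ h1] := beta_b n I0; have h2 := betaE n I0; have /andP[h3 _] := q_bounds n I0.
have h4 := muM n; have d0 := delta_gt0.
by move: h1 h2 h3; rewrite !subr0 !mul1r mulr1 => h1 h2 h3; lra.
Qed.

Let gamma j := b j / (2 * mu j * m j.+1).

Lemma gamma_ge0 j : 0 <= gamma j.
Proof. by rewrite divr_ge0 ?fact_moment_ge0// !mulr_ge0// ltW// means_gt0. Qed.

Lemma gammaE j : gamma j = (b j / (2 * mu j ^+ 2)) / m j.
Proof.
rewrite /gamma mS; field.
by have := mu_gt0 j; have := means_gt0 j; lra.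
Qed.

Lemma Gamma_sumS n : G n.+1 = G n + gamma n.
Proof. by rewrite /G big_ord_recr. Qed.

Lemma Gamma_sum_ge0 n : 0 <= G n.
Proof. by apply: sumr_ge0 => j _; exact: gamma_ge0. Qed.

Lemma Gamma_sum_homo n p : (n <= p)%N -> G n <= G p.
Proof.
move=> /subnK <-; elim: (p - n)%N => [//|k IH].
by rewrite addSn Gamma_sumS (le_trans IH)// lerDl gamma_ge0.
Qed.

(** At s = 0, [b j / 2] is at least [beta j 0], hence at least [eps]. This is what lets sums of 1 /
    m_j be controlled by [G]. *)
Lemma gamma_lower j : (N0 <= j)%N -> eps / M ^+ 2 / m j <= gamma j.
Proof.
move=> Nj; rewrite gammaE ler_pM2r ?invr_gt0 ?means_gt0//.
have H2 := beta_eps Nj I0; have /andP[H1 _] := beta_b j I0.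
rewrite [in leRHS]invfM [leRHS]mulrA; apply: ler_pM.
- exact: ltW.
- by rewrite invr_ge0 exprn_ge0// ltW.
- by lra.
by rewrite lef_pV2 ?posrE ?exprn_gt0// lerXn2r ?nnegrE// ltW.
Qed.

Lemma gamma_upper j : gamma j <= 2 * M / delta ^+ 2 / m j.
Proof.
rewrite gammaE ler_pM2r ?invr_gt0 ?means_gt0//.
rewrite [in leLHS]invfM [leLHS]mulrA; apply: ler_pM.
- by rewrite divr_ge0// fact_moment_ge0.
- by rewrite invr_ge0 exprn_ge0// ltW.
- by have := fact_moment_le j; lra.
by rewrite lef_pV2 ?posrE ?exprn_gt0// lerXn2r ?nnegrE ?mean_ge_delta// ltW.
Qed.


Let m_inv_gt0 n : 0 < (m n)^-1. Proof. by rewrite invr_gt0 means_gt0. Qed.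

Lemma inv_means_small e : 0 < e -> \forall n \near \oo, (m n)^-1 <= e * G n.
Proof.
move=> e0; near=> n.
have : e^-1 <= m n * G n by near: n; move/cvgryPge : mG_infty; apply.
rewrite -ler_pdivrMl ?means_gt0// => h.
by rewrite -ler_pdivrMl// mulrC.
Unshelve. all: by end_near. Qed.

(** Since 1 / m_i need not be monotone, the largest of 1 / m_0, .., 1 / m_n has to be controlled:
    finitely many early indices go into K, and the later ones use [G i <= G n]. *)
Lemma inv_means_bounded e : 0 < e ->
  exists2 K, 0 <= K & forall n i, (i <= n)%N -> (m i)^-1 <= K + e * G n.
Proof.
move=> e0; have [N _ HN] := inv_means_small e0.
exists (\sum_(i < N) (m i)^-1); first by apply: sumr_ge0 => i _; exact: ltW.
move=> n i ni; have [iN|Ni] := ltnP i N.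
  rewrite (bigD1 (Ordinal iN))//= -addrA lerDl addr_ge0//.
    by apply: sumr_ge0 => j _; exact: ltW.
  by rewrite mulr_ge0 ?Gamma_sum_ge0// ltW.
rewrite (le_trans (HN i Ni))// ler_wpDl//.
  by apply: sumr_ge0 => j _; exact: ltW.
by rewrite ler_pM2l// Gamma_sum_homo.
Qed.

(** From [N0] on, 1 / m_k is at most a multiple of the increment of [G], so the sum telescopes. The
    shift from m_k to m_(k+1) adds the single term 1 / m_n, covered by [inv_means_bounded]. *)
Lemma sum_inv_means_bounded :
  exists K, forall n, \sum_(0 <= k < n) (m k.+1)^-1 <= K * (1 + G n).
Proof.
have [K0 K00 HK0] := inv_means_bounded ltr01.
pose c := eps / M ^+ 2.
have c_gt0 : 0 < c by rewrite divr_gt0// exprn_gt0.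
pose T := \sum_(k < N0) (m k)^-1.
have T0 : 0 <= T by apply: sumr_ge0 => i _; exact: ltW.
have H n : \sum_(0 <= k < n) (m k)^-1 <= T + c^-1 * G n.
  elim: n => [|n IH]; first by rewrite big_geq// addr_ge0// mulr_ge0 ?invr_ge0 ?Gamma_sum_ge0// ltW.
  rewrite big_nat_recr//= Gamma_sumS mulrDr addrA.
  have [nN|Nn] := ltnP n N0; last first.
    by rewrite lerD// mulrC ler_pdivlMr// mulrC gamma_lower.
  apply: (@le_trans _ _ T); last first.
    by rewrite -addrA lerDl addr_ge0// mulr_ge0 ?invr_ge0 ?Gamma_sum_ge0 ?gamma_ge0// ltW.
  rewrite -(big_nat_recr n 0 (fun k => (m k)^-1))//= /T -(big_mkord xpredT (fun k => (m k)^-1)).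
  by rewrite (big_cat_nat (n := n.+1) (p := N0))//= lerDl sumr_ge0// => i _; exact: ltW.
exists (T + K0 + c^-1 + 1) => n.
have : \sum_(0 <= k < n) (m k.+1)^-1 <= \sum_(0 <= k < n.+1) (m k)^-1.
  by rewrite [leRHS]big_nat_recl//= lerDr ltW.
rewrite big_nat_recr//=.
have := H n; have := HK0 n n (leqnn n); have G0 := Gamma_sum_ge0 n; rewrite mul1r.
have : 0 <= (T + K0) * G n by rewrite mulr_ge0// addr_ge0.
have : 0 <= c^-1 by rewrite invr_ge0 ltW.
nra.
Qed.

(* The shape function of [g n]: 1 / (1 - g n s) = 1 / (mu n * (1 - s)) + shape n s. *)
Definition shape n (s : R) := beta n s / (mu n * q n s).

Lemma shape_lower n s : (N0 <= n)%N -> 0 <= s < 1 -> eps / M ^+ 2 <= shape n s.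
Proof.
move=> Nn s01; have /andP[h1 h2] := q_bounds n s01.
have q0 : 0 < q n s by exact: lt_le_trans h1.
have h := muM n.
rewrite /shape; apply: ler_pM.
- exact: ltW.
- by rewrite invr_ge0 exprn_ge0// ltW.
- exact: beta_eps.
rewrite lef_pV2 ?posrE ?exprn_gt0 ?mulr_gt0// expr2.
apply: ler_pM => //; [exact: ltW|exact: ltW|exact: le_trans h].
Qed.

(** Over a common denominator, at least delta^3, the numerator is a difference of two nonnegative
    terms, (b / 2) (mu - q) and (b / 2 - beta) mu. Each is at most 4 M^2 (1 - s), hence so is the
    absolute value of their difference. *)
Lemma shape_approx n s : 0 <= s < 1 ->
  `|shape n s - b n / (2 * mu n ^+ 2)| <= 4 * M ^+ 2 / delta ^+ 3 * (1 - s).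
Proof.
move=> s01; have /andP[h1 h2] := q_bounds n s01.
have q0 : 0 < q n s by exact: lt_le_trans h1.
have mu0 := mu_gt0 n; have muM' := muM n.
have t0 : 0 <= 1 - s by case/andP: s01; lra.
have -> : shape n s - b n / (2 * mu n ^+ 2) =
    ((b n / 2) * (mu n - q n s) - (b n / 2 - beta n s) * mu n) / (mu n ^+ 2 * q n s).
  by rewrite /shape; field; lra.
rewrite betaE// normrM normfV [X in _ / X]gtr0_norm; last first.
  by rewrite mulr_gt0// exprn_gt0.
have B0 := fact_moment_ge0 n; have B1 := fact_moment_le n.
have /andP[B2 B3] := beta_b n s01; have B4 := beta_ge0 n s01.
have M0 := M_gt0.
rewrite ler_pdivrMr; last by rewrite mulr_gt0// exprn_gt0.
apply: (@le_trans _ _ (4 * M ^+ 2 * (1 - s))).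
  have Hb : beta n s <= 2 * M by lra.
  have H1 : 0 <= b n / 2 * ((1 - s) * beta n s) <= 4 * M ^+ 2 * (1 - s).
    apply/andP; split; first by rewrite !mulr_ge0//; lra.
    have -> : 4 * M ^+ 2 * (1 - s) = (2 * M) * ((1 - s) * (2 * M)) by ring.
    by apply: ler_pM; [lra|exact: mulr_ge0|lra|apply: ler_pM => //; lra].
  have H2 : 0 <= (b n / 2 - beta n s) * mu n <= 4 * M ^+ 2 * (1 - s).
    apply/andP; split; first by rewrite !mulr_ge0//; lra.
    apply: (@le_trans _ _ (M * (1 - s) * M)); first by apply: ler_pM => //; lra.
    have : 0 <= M ^+ 2 * (1 - s) by rewrite mulr_ge0// exprn_ge0// ltW.
    by rewrite expr2; lra.
  by rewrite ler_norml; apply/andP; split; lra.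
have -> : 4 * M ^+ 2 / delta ^+ 3 * (1 - s) * (mu n ^+ 2 * q n s) =
    4 * M ^+ 2 * (1 - s) * ((mu n ^+ 2 * q n s) / delta ^+ 3) by ring.
rewrite ler_peMr ?mulr_ge0 ?exprn_ge0 ?(ltW M0)//.
rewrite ler_pdivlMr ?exprn_gt0// mul1r [leLHS]exprSr.
have d0 := delta_gt0; have dm := mean_ge_delta n.
by apply: ler_pM => //; [rewrite exprn_ge0// ltW|exact: ltW|rewrite lerXn2r ?nnegrE// ltW].
Qed.


(** The orbit is quantified after the threshold on n, so that its endpoint [u n] may later depend on
    n. *)
Lemma reciprocal_orbit e : 0 < e -> \forall n \near \oo, forall u : nat -> R,
  0 <= u n < 1 -> (forall j, (j < n)%N -> u j = g j (u j.+1) :> R) ->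
  `|(1 - u 0%N)^-1 - (m n * (1 - u n))^-1 - G n| <= e * G n.
Proof.
move=> e_gt0.
(* The bound eps / M^2 is for the shape terms; the minimum with 1 lets the same constant serve for
   the endpoint term 1 / (m_n (1 - u_n)). *)
pose c := Num.min 1 (eps / M ^+ 2).
have c_gt0 : 0 < c by rewrite lt_min ltr01 divr_gt0// exprn_gt0.
pose C := 4 * M ^+ 2 / delta ^+ 3.
have C_gt0 : 0 < C by rewrite divr_gt0 ?exprn_gt0// mulr_gt0// exprn_gt0.
pose K0 := C * \sum_(j < N0) (m j)^-1.
have K0_ge0 : 0 <= K0.
  by rewrite mulr_ge0 ?(ltW C_gt0)//; apply: sumr_ge0 => i _; exact: ltW.
pose K1 := C * M / c.
have K1_gt0 : 0 < K1 by rewrite divr_gt0// mulr_gt0.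
pose a k := (m k.+1)^-1.
have a_gt0 k : 0 < a k by exact: m_inv_gt0.
(* this error bound does not depend on the orbit *)
have small : \forall n \near \oo,
    K0 + K1 * \sum_(0 <= i < n) a i ^+ 2 / (\sum_(i <= k < n) a k) <= e * G n.
  have [K HK] := sum_inv_means_bounded.
  have KK : 0 <= 2 * K.
    have := HK 0%N; rewrite big_geq// /G big_ord0 addr0; lra.
  (* Chosen so that 2 e1 * 2 (2 K + 1) = (e / (4 K1))^2. The square root, the factor 2 of
     [sum_sqr_div_tail] and K1 then give e / 2; the other half of e absorbs K0. *)
  pose e1 := (e / (8 * K1)) ^+ 2 / (2 * K + 1).
  have e1_gt0 : 0 < e1.
    rewrite divr_gt0 ?exprn_gt0 ?divr_gt0//; first by rewrite mulr_gt0.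
    lra.
  have [A A_ge0 HA] := inv_means_bounded e1_gt0.
  near=> n.
  have G1 : 1 <= G n by near: n; move/cvgryPge : G_infty; apply.
  have Gn_ge : A / e1 <= G n by near: n; move/cvgryPge : G_infty; apply.
  have Gn_ge2 : 2 * K0 / e <= G n by near: n; move/cvgryPge : G_infty; apply.
  have aG k : (k < n)%N -> a k <= 2 * e1 * G n.
    by move=> kn; have := HA n k.+1 kn; move: Gn_ge; rewrite ler_pdivrMr// /a; lra.
  have tail := sum_sqr_div_tail a_gt0 aG.
  have root : Num.sqrt (2 * e1 * G n) * Num.sqrt (\sum_(0 <= k < n) a k) <=
      e / (4 * K1) * G n.
    have z_ge0 : 0 <= e / (4 * K1) * G n.
      by rewrite mulr_ge0 ?Gamma_sum_ge0// divr_ge0 ?(ltW e_gt0)// mulr_ge0// ltW.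
    have e1G : 0 <= 2 * e1 * G n by rewrite mulr_ge0 ?Gamma_sum_ge0// mulr_ge0// ltW.
    rewrite -sqrtrM// -[leRHS](ger0_norm z_ge0) -sqrtr_sqr ler_wsqrtr//.
    apply: (@le_trans _ _ (2 * e1 * G n * (2 * (2 * K + 1) * G n))).
      apply: ler_wpM2l => //; apply: le_trans (HK n) _.
      have : 0 <= 2 * K * (G n - 1) by rewrite mulr_ge0// subr_ge0.
      have : 0 <= 2 * K * G n by rewrite mulr_ge0 ?Gamma_sum_ge0.
      by lra.
    rewrite /e1 le_eqVlt; apply/orP; left; apply/eqP; field.
    by have := K1_gt0; lra.
  have H1 : K1 * \sum_(0 <= i < n) a i ^+ 2 / (\sum_(i <= k < n) a k) <= e / 2 * G n.
    apply: (@le_trans _ _ (K1 * (2 * (e / (4 * K1) * G n)))).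
      rewrite ler_pM2l//; apply: le_trans tail _.
      by rewrite -mulrA ler_pM2l.
    rewrite le_eqVlt; apply/orP; left; apply/eqP; field.
    by have := K1_gt0; lra.
  move: Gn_ge2; rewrite ler_pdivrMr//; lra.
have [N _ HN] := small.
exists N => // n /= Nn u un ug; apply: le_trans (HN n Nn).
have u01 j : (j <= n)%N -> 0 <= u j < 1.
  move=> jn; rewrite -(subKn jn); elim: (n - j)%N (leq_subr j n) => [|k IH] kn.
    by rewrite subn0.
  have lt_n : (n - k.+1 < n)%N by rewrite ltn_subrL (leq_trans _ kn).
  have := IH (ltnW kn); rewrite -(subnSK kn) => u01.
  rewrite ug// g_ge0//= -subr_gt0 qE// mulr_gt0//; first by case/andP: u01; lra.
  by have /andP[h _] := q_bounds (n - k.+1)%N u01; exact: lt_le_trans h.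
have v_gt0 j : (j <= n)%N -> 0 < 1 - u j by move=> /u01/andP[]; lra.
pose x j := (m j * (1 - u j))^-1.
have x_gt0 j : (j <= n)%N -> 0 < x j.
  by move=> jn; rewrite invr_gt0 mulr_gt0 ?means_gt0 ?v_gt0.
have xS j : (j < n)%N -> x j = x j.+1 + shape j (u j.+1) / m j.
  move=> jn; rewrite /x ug// qE ?u01// mS /shape.
  have bE := betaE j (u01 j.+1 jn).
  have /andP[h1 h2] := q_bounds j (u01 j.+1 jn).
  have := v_gt0 j.+1 jn; have := means_gt0 j; have := mu_gt0 j.
  have q0 : 0 < q j (u j.+1) by exact: lt_le_trans h1.
  have -> : beta j (u j.+1) = (mu j - q j (u j.+1)) / (1 - u j.+1).
    by rewrite bE mulrAC divff ?mul1r// gt_eqF// v_gt0.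
  by move=> *; field; lra.
have x0E : x 0%N = x n + \sum_(0 <= j < n) shape j (u j.+1) / m j.
  have H k : (k <= n)%N -> x 0%N = x k + \sum_(0 <= j < k) shape j (u j.+1) / m j.
    elim: k => [|k IH] kn; first by rewrite big_geq// addr0.
    by rewrite IH 1?ltnW// big_nat_recr//= xS//; ring.
  exact: H.
(* Backward induction from n. As [a i] is 1 / m_(i+1), the shape term of index j + 1 pays for [a j],
   and the endpoint [x n] pays for the last one, [a n.-1]. *)
have x_ge k j : (N0 <= j)%N -> (j + k.+1)%N = n -> c * \sum_(j <= i < n) a i <= x j.+1.
  have c_le1 : c <= 1 by rewrite ge_min lexx.
  elim: k j => [|k IH] j Nj jn.
    have En : n = j.+1 by rewrite -jn addn1.
    have vn := v_gt0 n (leqnn n).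
    rewrite En big_nat1 /x -En invfM mulrC /a -En ler_pM2l//.
    rewrite (le_trans c_le1)// invf_ge1//.
    by case/andP: un; lra.
  have jn' : (j.+1 < n)%N by rewrite -jn addnS ltnS addnS ltnS leq_addr.
  rewrite big_ltn ?(ltnW jn')// mulrDr xS// addrC lerD//.
    by apply: IH; [exact: leqW|rewrite addSnnS].
  rewrite ler_pM2r//; apply: le_trans (shape_lower (leqW Nj) (u01 _ jn')).
  by rewrite ge_min lexx orbT.
have -> : (1 - u 0%N)^-1 = x 0%N by rewrite /x m0 mul1r.
rewrite -/(x n) x0E.
rewrite [X in `|X|](_ : _ = \sum_(0 <= j < n)
    (shape j (u j.+1) - b j / (2 * mu j ^+ 2)) / m j); last first.
  rewrite [x n + _]addrC addrK /G -(big_mkord xpredT gamma) -sumrB.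
  by apply: eq_bigr => j _; rewrite mulrBl -gammaE.
apply: le_trans (ler_norm_sum _ _ _) _.
(* Below [N0] the shape functions have no positive lower bound, so 1 - u is only bounded by 1; the
   total cost K0 does not depend on n. *)
apply: (@le_trans _ _ (\sum_(0 <= j < n) ((if (j < N0)%N then C / m j else 0) +
    K1 * (a j ^+ 2 / (\sum_(j <= k < n) a k))))).
  rewrite big_nat [leRHS]big_nat; apply: ler_sum => j /andP[_ jn].
  rewrite normrM (gtr0_norm (m_inv_gt0 j)).
  have sum_gt0 : 0 < \sum_(j <= k < n) a k.
    by rewrite big_ltn// ltr_pwDl// sumr_ge0// => i _; exact: ltW.
  apply: (@le_trans _ _ (C * (1 - u j.+1) / m j)).
    by rewrite ler_pM2r// shape_approx// u01.
  have r_ge0 : 0 <= K1 * (a j ^+ 2 / (\sum_(j <= k < n) a k)).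
    by rewrite mulr_ge0 ?(ltW K1_gt0)// divr_ge0 ?exprn_ge0// ltW.
  case: ltnP => [jN|Nj].
    rewrite ler_wpDr// ler_pM2r// ler_piMr ?(ltW C_gt0)//.
    by have := u01 j.+1 jn; lra.
  rewrite add0r.
  have hx : c * \sum_(j <= k < n) a k <= x j.+1.
    by apply: (x_ge (n - j.+1)%N) => //; rewrite -addSnnS subnKC.
  have v_le : 1 - u j.+1 <= a j / (c * \sum_(j <= k < n) a k).
    rewrite ler_pdivlMr ?mulr_gt0//.
    apply: le_trans (ler_wpM2l (ltW (v_gt0 _ jn)) hx) _.
    by rewrite /x invfM mulrCA divff ?mulr1// gt_eqF// v_gt0.
  apply: (@le_trans _ _ (C * (a j / (c * \sum_(j <= k < n) a k)) * (M * a j))).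
    have -> : (m j)^-1 = mu j * a j.
      by rewrite /a mS invfM mulrC divfK// gt_eqF.
    apply: ler_pM.
    - by rewrite mulr_ge0 ?(ltW C_gt0)// ltW// v_gt0.
    - by rewrite mulr_ge0// ltW.
    - by rewrite ler_pM2l.
    - by rewrite ler_pM2r.
  rewrite /K1 le_eqVlt; apply/orP; left; apply/eqP; field.
  by have := c_gt0; lra.
rewrite big_split/= -mulr_sumr lerD2r /K0 mulr_sumr.
pose F j := if (j < N0)%N then C / m j else 0.
have F_ge0 j : 0 <= F j by rewrite /F; case: ifP => // _; rewrite divr_ge0 ?ltW ?means_gt0.
(* Padding the range to N0 + n avoids comparing n with N0. *)
apply: (@le_trans _ _ (\sum_(0 <= j < N0 + n) F j)).
  by rewrite [leRHS](big_cat_nat (n := n)) ?leq_addl//= lerDl sumr_ge0.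
have F0 : \sum_(N0 <= j < N0 + n) F j = 0.
  by rewrite big_nat big1// => i /andP[Ni _]; rewrite /F ltnNge Ni.
rewrite (big_cat_nat (n := N0)) ?leq_addr//= F0 addr0.
rewrite big_mkord le_eqVlt; apply/orP; left; apply/eqP.
by apply: eq_bigr => i _; rewrite /F ltn_ord.
Unshelve. all: by end_near. Qed.

End reciprocal.

(** * Moment recursions and the Stolz-Cesaro theorem *)

Lemma near_cvg (R : realType) (f g : nat -> R) (l : R) :
  (\forall n \near \oo, f n = g n) ->
  g n @[n --> \oo] --> l -> f n @[n --> \oo] --> l.
Proof.
by move=> fg; apply: cvg_trans; apply: near_eq_cvg; apply: filterS fg => n ->.
Qed.

Lemma cvgr_sum (R : realType) (I : Type) (r : seq I) (P : pred I)
    (f : I -> nat -> R) (l : I -> R) :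
  (forall i, P i -> f i n @[n --> \oo] --> l i) ->
  \sum_(i <- r | P i) f i n @[n --> \oo] --> \sum_(i <- r | P i) l i.
Proof.
move=> fl; elim: r => [|i r IH].
  by rewrite big_nil; under eq_fun do rewrite big_nil; exact: cvg_cst.
rewrite big_cons; under eq_fun do rewrite big_cons.
by case: ifPn => // Pi; apply: cvgD => //; exact: fl.
Qed.

Lemma cvgr_exp (R : realType) (f : nat -> R) (l : R) (k : nat) :
  f n @[n --> \oo] --> l -> f n ^+ k @[n --> \oo] --> l ^+ k.
Proof.
move=> fl; elim: k => [|k IH].
  by under eq_fun do rewrite expr0; exact: cvg_cst.
by rewrite exprS; under eq_fun do rewrite exprS; exact: cvgM.
Qed.

(** The increments of x - l y are at most (e / 2) times those of y from some N on, and these bounds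
    telescope; what is left at N is constant and disappears on division by [y n]. *)
Lemma stolz_cesaro (R : realType) (x y : nat -> R) (l : R) :
  (\forall n \near \oo, y n < y n.+1) -> y n @[n --> \oo] --> +oo ->
  (x n.+1 - x n) / (y n.+1 - y n) @[n --> \oo] --> l ->
  x n / y n @[n --> \oo] --> l.
Proof.
move=> y_incr y_oo dxy; apply/cvgrPdist_le => e e0.
have e3 : 0 < e / 2 by lra.
have [N _ HN] : \forall n \near \oo,
    `|x n.+1 - x n - l * (y n.+1 - y n)| <= e / 2 * (y n.+1 - y n).
  near=> n.
  have dy : 0 < y n.+1 - y n by rewrite subr_gt0; near: n.
  have -> : x n.+1 - x n - l * (y n.+1 - y n) =
      ((x n.+1 - x n) / (y n.+1 - y n) - l) * (y n.+1 - y n).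
    by rewrite mulrBl divfK// gt_eqF.
  rewrite normrM (gtr0_norm dy) ler_pM2r// distrC.
  by near: n; move/cvgrPdist_le : dxy; apply.
have H n : (N <= n)%N ->
    `|x n - x N - l * (y n - y N)| <= e / 2 * (y n - y N).
  move=> /subnKC <-; elim: (n - N)%N => [|k IH].
    by rewrite addn0 !subrr mulr0 subr0 normr0 mulr0.
  have := HN (N + k)%N (leq_addr _ _) => /= HNk; rewrite addnS.
  have -> : x (N + k).+1 - x N - l * (y (N + k).+1 - y N) =
    (x (N + k)%N - x N - l * (y (N + k)%N - y N)) +
    (x (N + k).+1 - x (N + k)%N - l * (y (N + k).+1 - y (N + k)%N)) by ring.
  apply: le_trans (ler_normD _ _) _; lra.
near=> n.
have Nn : (N <= n)%N by near: n; exact: nbhs_infty_ge.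
pose B := `|x N - l * y N| + e / 2 * `|y N|.
have y1 : 1 <= y n by near: n; move/cvgryPge : y_oo; apply.
have yB : B / (e / 2) <= y n by near: n; move/cvgryPge : y_oo; apply.
have y0 : 0 < y n by lra.
have -> : l - x n / y n = - ((x n - l * y n) / y n).
  by field; lra.
rewrite normrN normf_div (gtr0_norm y0) ler_pdivrMr//.
have -> : x n - l * y n = (x n - x N - l * (y n - y N)) + (x N - l * y N) by ring.
apply: le_trans (ler_normD _ _) _.
apply: le_trans (lerD (H n Nn) (lexx _)) _.
move: yB; rewrite ler_pdivrMr// /B.
have : - (e / 2 * y N) <= e / 2 * `|y N|.
  by rewrite -mulrN ler_pM2l// -normrN ler_norm.
lra.
Unshelve. all: by end_near. Qed.

Section moment_recursion.
Context (R : realType) (gamma G a : nat -> R) (w : nat -> nat -> R) (K : nat -> R) (c : R).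
Hypothesis GS : forall n, G n.+1 = G n + gamma n :> R.
Hypothesis G_infty : G n @[n --> \oo] --> +oo.
Hypothesis a_gt0 : forall n, 0 < a n.
Hypothesis a_small : a n / G n @[n --> \oo] --> (0 : R).
Hypothesis c_gt0 : 0 < c.
Hypothesis gamma_ge : \forall n \near \oo, c * a n <= gamma n.
Hypothesis gamma_small : gamma n / G n @[n --> \oo] --> (0 : R).
Hypothesis w_ge0 : forall r n, 0 <= w r n.
Hypothesis w1 : forall n, w 1%N n = 1 :> R.
Hypothesis K_ge0 : forall s, 0 <= K s.
Hypothesis w_rec : forall s n,
  `|w s.+2 n.+1 - w s.+2 n - s.+1%:R * gamma n * w s.+1 n| <=
    K s * \sum_(1 <= l < s.+1) w l n * a n ^+ (s.+2 - l).

Let G_gt0 : \forall n \near \oo, 0 < G n.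
Proof. by move/cvgryPgt : G_infty; apply. Qed.

Let gamma_gt0 : \forall n \near \oo, 0 < gamma n.
Proof.
by near=> n; apply: (@lt_le_trans _ _ (c * a n)); [rewrite mulr_gt0|near: n].
Unshelve. all: by end_near. Qed.

(** In the application [a n] is 1 / m_n. The increments of w_(s+2) and of G^(s+1) are both divided
    by gamma G^s, and both quotients tend to s + 1. *)
Lemma moment_asymptotics s :
  w s.+1 n / G n ^+ s @[n --> \oo] --> (1 : R).
Proof.
elim/ltn_ind: s => -[_|s IH].
  under eq_fun do rewrite w1 expr0 divr1.
  exact: cvg_cst.
have G_ratio : G n.+1 / G n @[n --> \oo] --> (1 : R).
  have h : 1 + gamma n / G n @[n --> \oo] --> (1 + 0 : R).
    by apply: cvgD => //; exact: cvg_cst.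
  rewrite addr0 in h.
  apply: near_cvg h; near=> n.
  by rewrite /= GS mulrDl divff// gt_eqF//; near: n.
apply: stolz_cesaro.
- near=> n.
  have g0 : 0 < gamma n by near: n.
  have G0 : 0 < G n by near: n.
  rewrite ltrXn2r ?nnegrE ?(ltW G0)//; rewrite GS; lra.
- apply/cvgryPge => A; near=> n.
  have G1 : 1 <= G n by near: n; move/cvgryPge : G_infty; apply.
  have GA : A <= G n by near: n; move/cvgryPge : G_infty; apply.
  by rewrite (le_trans GA)// exprS ler_peMr ?exprn_ege1//; lra.
have y_incr : (G n.+1 ^+ s.+1 - G n ^+ s.+1) / (gamma n * G n ^+ s) @[n --> \oo] -->
    (s.+1%:R : R).
  have : \sum_(i < s.+1) (G n.+1 / G n) ^+ (s - i) @[n --> \oo] --> (\sum_(i < s.+1) 1 : R).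
    apply: (cvgr_sum (f := fun (i : 'I_s.+1) n => _)) => i _.
    by have := cvgr_exp (k := (s - i)%N) G_ratio; rewrite expr1n.
  rewrite sumr_const card_ord; apply: near_cvg; near=> n.
  have g0 : 0 < gamma n by near: n.
  have G0 : 0 < G n by near: n.
  rewrite subrXX GS addrAC subrr add0r -mulf_div divff ?mul1r ?gt_eqF//.
  rewrite mulr_suml; apply: eq_bigr => i _.
  have -> : G n ^+ s = G n ^+ (s - i) * G n ^+ i.
    by rewrite -exprD subnK// -ltnS ltn_ord.
  rewrite expr_div_n; set p := G n ^+ (s - i); set q := G n ^+ i.
  have p0 : 0 < p by rewrite exprn_gt0.
  have q0 : 0 < q by rewrite exprn_gt0.
  by rewrite /=; field; rewrite !gt_eqF.
have x_incr : (w s.+2 n.+1 - w s.+2 n) / (gamma n * G n ^+ s) @[n --> \oo] -->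
    (s.+1%:R : R).
  pose e n := w s.+2 n.+1 - w s.+2 n - s.+1%:R * gamma n * w s.+1 n.
  (* In each error term one factor a is traded for gamma / c. What remains, w_l a^(s+1-l), is
     o(G^s): w_l is of order G^(l-1) by induction, a = o(G), and the exponent is positive because l
     <= s. *)
  have e_small : e n / (gamma n * G n ^+ s) @[n --> \oo] --> (0 : R).
    have : K s / c * \sum_(1 <= l < s.+1) (w l n / G n ^+ l.-1) * (a n / G n) ^+ (s.+1 - l)
        @[n --> \oo] --> (K s / c * \sum_(1 <= l < s.+1) (1 * 0 ^+ (s.+1 - l)) : R).
      apply: cvgM; first exact: cvg_cst.
      rewrite big_nat; under eq_fun do rewrite big_nat.
      apply: (cvgr_sum (f := fun l n => (w l n / G n ^+ l.-1) * (a n / G n) ^+ (s.+1 - l))).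
      move=> -[//|l] /= ls.
      apply: cvgM; first by apply: IH; exact: ltnW.
      exact: cvgr_exp.
    have -> : \sum_(1 <= l < s.+1) (1 * 0 ^+ (s.+1 - l)) = 0 :> R.
      by rewrite big_nat big1// => l /andP[_ ls]; rewrite mul1r expr0n subn_eq0 leqNgt ls.
    rewrite mulr0 => h; apply/norm_cvg0P.
    apply: (squeeze_cvgr _ (cvg_cst 0) h); near=> n; rewrite normr_ge0/=.
    have g0 : 0 < gamma n by near: n.
    have cg : c * a n <= gamma n by near: n.
    have G0 : 0 < G n by near: n.
    have p0 : 0 < gamma n * G n ^+ s by rewrite mulr_gt0// exprn_gt0.
    rewrite normf_div (gtr0_norm p0) ler_pdivrMr//; apply: le_trans (w_rec s n) _.
    rewrite -!mulrA; apply: ler_wpM2l => //.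
    rewrite mulr_suml mulr_sumr big_nat [leRHS]big_nat; apply: ler_sum => -[//|l] /= ls.
    have ls1 : (l <= s)%N by exact: ltnW.
    have -> : (s.+2 - l.+1 = (s - l).+1)%N by rewrite subSS subSn.
    have -> : (s.+1 - l.+1 = s - l)%N by [].
    have -> : G n ^+ s = G n ^+ l * G n ^+ (s - l) by rewrite -exprD subnKC.
    rewrite expr_div_n exprS; set x := a n ^+ _; set y := G n ^+ l; set z := G n ^+ _.
    have y0 : 0 < y by rewrite exprn_gt0.
    have z0 : 0 < z by rewrite exprn_gt0.
    have x0 : 0 <= x by rewrite exprn_ge0// ltW.
    have -> : c^-1 * (w l.+1 n / y * (x / z) * (gamma n * (y * z))) = w l.+1 n * x * (gamma n / c).
      by field; rewrite !gt_eqF.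
    rewrite mulrCA mulrC ler_wpM2l ?mulr_ge0//.
    by rewrite ler_pdivlMr// mulrC.
  have -> : s.+1%:R = s.+1%:R * 1 + 0 :> R by rewrite mulr1 addr0.
  have h : s.+1%:R * (w s.+1 n / G n ^+ s) + e n / (gamma n * G n ^+ s) @[n --> \oo] -->
      (s.+1%:R * 1 + 0 : R).
    by apply: cvgD => //; apply: cvgM; [exact: cvg_cst|exact: IH].
  apply: near_cvg h; near=> n.
  have g0 : 0 < gamma n by near: n.
  have G0 : 0 < G n ^+ s by rewrite exprn_gt0//; near: n.
  by rewrite /= /e; field; rewrite !gt_eqF.
have s0 : s.+1%:R != 0 :> R by rewrite pnatr_eq0.
rewrite -(divff s0).
apply: near_cvg (cvgM x_incr (cvgV s0 y_incr)); near=> n.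
have g0 : 0 < gamma n by near: n.
have G0 : 0 < G n by near: n.
rewrite /= invf_div mulrA divfK//.
by rewrite gt_eqF// mulr_gt0// exprn_gt0.
Unshelve. all: by end_near. Qed.

End moment_recursion.

(** * From moments on the unit interval to the uniform law *)

Definition bounded_real (R : realType) (V : Type) (f : V -> R) :=
  exists A : R, forall v, `|f v| <= A.

Section bernstein.
Context (R : realType).

Definition bernstein (N k : nat) (y : R) : R :=
  'C(N, k)%:R * (y ^+ k * (1 - y) ^+ (N - k)).

Lemma bernstein_ge0 N k y : 0 <= y <= 1 -> 0 <= bernstein N k y.
Proof.
by case/andP=> y0 y1; rewrite mulr_ge0// mulr_ge0// exprn_ge0// subr_ge0.
Qed.

(** Pascal's rule: a binomial variable of size N + 1 is one Bernoulli trial plus a binomial variable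
    of size N. *)
Lemma sum_bernsteinS N y (f : nat -> R) :
  \sum_(k < N.+2) bernstein N.+1 k y * f k =
  y * \sum_(k < N.+1) bernstein N k y * f k.+1 +
  (1 - y) * \sum_(k < N.+1) bernstein N k y * f k.
Proof.
pose t (i : nat) := y ^+ i.+1 * (1 - y) ^+ (N - i) * f i.+1.
have -> : \sum_(k < N.+2) bernstein N.+1 k y * f k =
    bernstein N.+1 0 y * f 0%N + \sum_(i < N.+1) ('C(N, i.+1)%:R * t i + 'C(N, i)%:R * t i).
  rewrite big_ord_recl; congr (_ + _); apply: eq_bigr => i _.
  by rewrite /bernstein /bump/= ?add1n binS subSS natrD /t; ring.
rewrite big_split/= addrA addrC; congr (_ + _).
  by rewrite mulr_sumr; apply: eq_bigr => i _; rewrite /bernstein /t exprS; ring.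
rewrite big_ord_recr/= bin_small// mul0r addr0 [in RHS]big_ord_recl mulrDr.
congr (_ + _); first by rewrite /bernstein !bin0 !subn0 !expr0 exprS; ring.
rewrite mulr_sumr; apply: eq_bigr => i _.
by rewrite /bernstein /= /bump leq0n add1n /t -(subnSK (ltn_ord i)) [_ ^+ (N - i.+1).+1]exprS; ring.
Qed.

(** The centre c is arbitrary so that the induction closes: a success in the trial split off moves
    it to c - 1. *)
Lemma bernstein_variance N y (c : R) :
  \sum_(k < N.+1) bernstein N k y * (k%:R - c) ^+ 2 =
  N%:R * y * (1 - y) + (N%:R * y - c) ^+ 2.
Proof.
elim: N c => [|N IH] c.
  by rewrite big_ord1 /bernstein /= bin0 !expr0; ring.
rewrite (sum_bernsteinS N y (fun k => (k%:R - c) ^+ 2)).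
have E (k : nat) : k.+1%:R - c = k%:R - (c - 1) by rewrite -natr1; ring.
under eq_bigr do rewrite E.
by rewrite !IH -(@natr1 R N); ring.
Qed.

Lemma sum_bernstein N y : \sum_(k < N.+1) bernstein N k y = 1.
Proof.
rewrite -[RHS](expr1n R N) -[X in X ^+ _](subrK y 1) exprDn.
by apply: eq_bigr => k _; rewrite /bernstein mulr_natl [y ^+ _ * _]mulrC.
Qed.

(** The probability that a binomial variable with parameters N and y is at least j: a polynomial in
    y that approximates the indicator of y >= j / N. *)
Definition bernstein_tail (N j : nat) (y : R) : R :=
  \sum_(k < N.+1 | (j <= k)%N) bernstein N k y.

Lemma bernstein_tail_ge0 N j y : 0 <= y <= 1 -> 0 <= bernstein_tail N j y.
Proof. by move=> y01; apply: sumr_ge0 => k _; exact: bernstein_ge0. Qed.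

Lemma bernstein_tail_le1 N j y : 0 <= y <= 1 -> bernstein_tail N j y <= 1.
Proof.
move=> y01; rewrite -(sum_bernstein N y) /bernstein_tail big_mkcond/=.
by apply: ler_sum => k _; case: ifP => // _; exact: bernstein_ge0.
Qed.

(* Chebyshev's inequality for the binomial distribution. *)
Lemma bernstein_deviation N (P : pred nat) (y e : R) : 0 <= y <= 1 -> 0 < e ->
  (0 < N)%N -> (forall k, P k -> (N%:R * e) ^+ 2 <= (k%:R - N%:R * y) ^+ 2) ->
  \sum_(k < N.+1 | P k) bernstein N k y <= (N%:R * e ^+ 2)^-1.
Proof.
move=> y01 e0 N0 HP.
have N0' : (0 : R) < N%:R by rewrite ltr0n.
have Ne0 : 0 < (N%:R * e) ^+ 2 by rewrite exprn_gt0// mulr_gt0.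
rewrite -(ler_pM2r Ne0) mulr_suml.
apply: (@le_trans _ _ (\sum_(k < N.+1) bernstein N k y * (k%:R - N%:R * y) ^+ 2)).
  rewrite big_mkcond/=; apply: ler_sum => k _; case: ifPn => Pk.
    by rewrite ler_wpM2l ?bernstein_ge0// HP.
  by rewrite mulr_ge0 ?bernstein_ge0// sqr_ge0.
rewrite bernstein_variance subrr expr0n addr0.
have -> : (N%:R * e ^+ 2)^-1 * (N%:R * e) ^+ 2 = N%:R :> R.
  by field; rewrite !gt_eqF.
rewrite -mulrA ler_piMr ?ler0n//; nra.
Qed.

Lemma bernstein_tail_lower N j (y e : R) : 0 <= y <= 1 -> 0 < e -> (0 < N)%N ->
  j%:R + N%:R * e <= N%:R * y -> 1 <= bernstein_tail N j y + (N%:R * e ^+ 2)^-1.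
Proof.
move=> y01 e0 N0 jy.
have {1}<- := sum_bernstein N y; rewrite (bigID (fun k : 'I__ => (j <= k)%N))/=.
rewrite lerD2l; apply: (bernstein_deviation (P := fun k => ~~ (j <= k)%N)) => // k.
rewrite -ltnNge => kj.
have kj' : k%:R <= j%:R :> R by rewrite ler_nat ltnW.
have Ne : 0 <= N%:R * e by rewrite mulr_ge0 ?ler0n// ltW.
by rewrite -[leRHS]sqrrN lerXn2r ?nnegrE//; lra.
Qed.

Lemma bernstein_tail_upper N j (y e : R) : 0 <= y <= 1 -> 0 < e -> (0 < N)%N ->
  N%:R * y + N%:R * e <= j%:R -> bernstein_tail N j y <= (N%:R * e ^+ 2)^-1.
Proof.
move=> y01 e0 N0 jy; apply: (bernstein_deviation (P := fun k => (j <= k)%N)) => // k jk.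
have jk' : j%:R <= k%:R :> R by rewrite ler_nat.
have Ne : 0 <= N%:R * e by rewrite mulr_ge0 ?ler0n// ltW.
by rewrite lerXn2r ?nnegrE//; lra.
Qed.

End bernstein.

Section karamata.
(** [L n] plays the expectation under the law of [zeta n], kept only as a normalized positive linear
    functional on bounded functions; [U n] plays exp(- zeta_n / E(zeta_n)). *)
Context (R : realType) (V : Type) (L : nat -> (V -> R) -> R) (U : nat -> V -> R).
Local Notation bdd := (@bounded_real R V).
Hypothesis L_add : forall n f g, bdd f -> bdd g -> L n (fun v => f v + g v) = L n f + L n g :> R.
Hypothesis L_scale : forall n c f, bdd f -> L n (fun v => c * f v) = c * L n f :> R.
Hypothesis L_mono : forall n f g, bdd f -> bdd g -> (forall v, f v <= g v) -> L n f <= L n g.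
Hypothesis L_one : forall n, L n (fun=> 1) = 1 :> R.
Hypothesis U01 : forall n v, 0 <= U n v <= 1.
Hypothesis U_moment : forall k, L n (fun v => U n v ^+ k) @[n --> \oo] --> (k.+1%:R^-1 : R).

Let bddI f : (forall v, 0 <= f v <= 1) -> bdd f.
Proof. by move=> f01; exists 1 => v; have /andP[f0 f1] := f01 v; rewrite ger0_norm. Qed.

Let bdd_scale c f : bdd f -> bdd (fun v => c * f v).
Proof. by move=> [M fM]; exists (`|c| * M) => v; rewrite normrM ler_wpM2l. Qed.

Let bdd_add f g : bdd f -> bdd g -> bdd (fun v => f v + g v).
Proof.
move=> [M fM] [M' gM]; exists (M + M') => v.
by rewrite (le_trans (ler_normD _ _))// lerD.
Qed.

Let bdd_cst c : bdd (fun=> c).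
Proof. by exists `|c|. Qed.

Let L_cst n c : L n (fun=> c) = c.
Proof.
rewrite -[RHS]mulr1 -[in RHS](L_one n) -L_scale; last exact: bdd_cst.
by congr (L n); apply/funext => v; rewrite mulr1.
Qed.

Let UV k l n v : 0 <= U n v ^+ k * (1 - U n v) ^+ l <= 1.
Proof.
have /andP[u0 u1] := U01 n v.
have h : 0 <= 1 - U n v <= 1 by lra.
case/andP: h => h0 h1.
by rewrite mulr_ge0 ?exprn_ge0//= mulr_ile1 ?exprn_ge0 ?exprn_ile1.
Qed.

(** The limit is Euler's integral B(k + 1, l + 1). The induction on l uses (1 - U)^(l+1) = (1 - U)^l
    - U (1 - U)^l. *)
Lemma beta_moment k l : L n (fun v => U n v ^+ k * (1 - U n v) ^+ l) @[n --> \oo] -->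
  ((k`! * l`!)%:R / (k + l).+1`!%:R : R).
Proof.
elim: l k => [|l IH] k.
  under eq_fun => n do under eq_fun do rewrite expr0 mulr1.
  have -> : (k`! * 0`!)%:R / (k + 0).+1`!%:R = k.+1%:R^-1 :> R; last exact: U_moment.
  have h : k`!%:R != 0 :> R by rewrite pnatr_eq0 -lt0n fact_gt0.
  rewrite fact0 muln1 addn0 factS natrM -(@natr1 R k); field; rewrite h natr1 pnatr_eq0.
  by [].
have -> : (k`! * l.+1`!)%:R / (k + l.+1).+1`!%:R =
    (k`! * l`!)%:R / (k + l).+1`!%:R - (k.+1`! * l`!)%:R / (k.+1 + l).+1`!%:R :> R.
  rewrite addSn addnS (factS (k + l).+1) (factS l) (factS k) !natrM.
  have h1 : (k + l)`!%:R != 0 :> R by rewrite pnatr_eq0 -lt0n fact_gt0.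
  have h3 : 1 + (k%:R + l%:R) != 0 :> R by rewrite -natrD nat1r pnatr_eq0.
  have h2 : k%:R + l%:R + 2 != 0 :> R by rewrite -!natrD pnatr_eq0 addn2.
  have -> : (k + l).+2%:R = k%:R + l%:R + 2 :> R by rewrite -addn2 !natrD.
  rewrite -(@natr1 R k) -(@natr1 R l). field.
  by apply/and3P; split.
apply: (near_cvg (g := fun n => L n (fun v => U n v ^+ k * (1 - U n v) ^+ l) -
    L n (fun v => U n v ^+ k.+1 * (1 - U n v) ^+ l))); last by apply: cvgB; exact: IH.
apply: nearW => n; rewrite -[X in _ - X]mul1r -mulNr -L_scale; last exact: bddI.
rewrite -L_add; [|exact: bddI|exact/bdd_scale/bddI].
by congr (L n); apply/funext => v; rewrite !exprS; ring.
Qed.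

Let bdd_bern N k n : bdd (fun v => bernstein N k (U n v)).
Proof. exact/bdd_scale/bddI. Qed.

(** The binomial coefficient cancels the factorials of the beta integral, leaving a value
    independent of k. *)
Lemma bernstein_moment N k : (k <= N)%N ->
  L n (fun v => bernstein N k (U n v)) @[n --> \oo] --> (N.+1%:R^-1 : R).
Proof.
move=> kN.
have -> : N.+1%:R^-1 = 'C(N, k)%:R * ((k`! * (N - k)`!)%:R / (k + (N - k)).+1`!%:R) :> R.
  have h : N`!%:R != 0 :> R by rewrite pnatr_eq0 -lt0n fact_gt0.
  by rewrite subnKC// mulrA -natrM bin_fact// factS natrM invfM mulrCA divff// mulr1.
under eq_fun => n do (rewrite L_scale; last exact: bddI).
by apply: cvgM; [exact: cvg_cst|exact: beta_moment].
Qed.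

Lemma bernstein_tail_moment N j : (j <= N.+1)%N ->
  L n (fun v => bernstein_tail N j (U n v)) @[n --> \oo] --> ((N.+1 - j)%:R / N.+1%:R : R).
Proof.
move=> jN.
have Lsum (s : seq 'I_N.+1) (P : pred 'I_N.+1) n :
    bdd (fun v => \sum_(k <- s | P k) bernstein N k (U n v)) /\
    L n (fun v => \sum_(k <- s | P k) bernstein N k (U n v)) =
    \sum_(k <- s | P k) L n (fun v => bernstein N k (U n v)).
  elim: s => [|k s [IH1 IH2]].
    under eq_fun do rewrite big_nil; rewrite big_nil; split; first exact: bdd_cst.
    exact: L_cst.
  under eq_fun do rewrite big_cons; rewrite big_cons.
  case: ifPn => // Pk; split; first exact: bdd_add.
  by rewrite L_add// IH2.
have -> : (N.+1 - j)%:R / N.+1%:R = \sum_(k < N.+1 | (j <= k)%N) N.+1%:R^-1 :> R.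
  rewrite -(big_mkord (fun k => (j <= k)%N) (fun=> N.+1%:R^-1)).
  by rewrite -(big_nat_widenl j 0 N.+1 xpredT)// sumr_const_nat mulr_natl.
under eq_fun do rewrite (Lsum _ _ _).2.
apply: (cvgr_sum (f := fun (k : 'I_N.+1) n => L n (fun v => bernstein N k (U n v)))) => k _.
by apply: bernstein_moment; rewrite -ltnS.
Qed.

(* As b_(N,k)(U) has limiting mean 1 / (N + 1), the mean of a tail of the
   Bernstein polynomials tends to that of the uniform law on {0, .., N}; such a
   tail is close to the indicator of [a <= U] away from a. *)
Lemma karamata (a : R) : 0 <= a <= 1 ->
  L n (fun v => (a <= U n v)%R%:R) @[n --> \oo] --> (1 - a : R).
Proof.
move=> /andP[a0 a1]; apply/cvgrPdist_le => e' e'0.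
pose e := Num.min 1 (e' / 5).
have e0 : 0 < e by rewrite lt_min ltr01 divr_gt0.
have e1 : e <= 1 by rewrite ge_min lexx.
have ee' : 5 * e <= e' by rewrite mulrC -ler_pdivlMr// ge_min lexx orbT.
(* N > e^(-3) makes both the Chebyshev bound 1 / (N e^2) and the mesh 1 / (N + 1) at most e.
   Rounding, Chebyshev and the limit together cost at most 5 e, whence the choice of e. *)
pose N := (Num.truncn (e ^- 3)).+1.
have N0 : (0 < N)%N by [].
have N_gt : e ^- 3 < N%:R by rewrite truncnS_gt.
have N0' : 0 < N%:R :> R by rewrite ltr0n.
have eN : 1 <= e ^+ 3 * N%:R.
  by rewrite -ler_pdivrMl ?exprn_gt0// mulr1 ltW.
have N_e : (N%:R * e ^+ 2)^-1 <= e.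
  rewrite -div1r ler_pdivrMr ?mulr_gt0 ?exprn_gt0//.
  by have -> : e * (N%:R * e ^+ 2) = e ^+ 3 * N%:R by ring.
have x_gt0 : 0 < N.+1%:R^-1 :> R by rewrite invr_gt0 ltr0n.
have x_eq : N%:R * N.+1%:R^-1 = 1 - N.+1%:R^-1 :> R.
  by rewrite -(@natr1 R N); field; rewrite natr1 pnatr_eq0.
have N_e1 : N.+1%:R^-1 <= e.
  rewrite -div1r ler_pdivrMr ?ltr0n//.
  apply: le_trans eN _; apply: ler_pM; rewrite ?ler0n ?exprn_ge0 ?(ltW e0)//.
    by rewrite exprS ler_piMr ?(ltW e0)// exprn_ile1// ltW.
  by rewrite ler_nat.
have tail_lim (j : nat) : (j <= N.+1)%N ->
    (N.+1 - j)%:R / N.+1%:R = 1 - j%:R * N.+1%:R^-1 :> R.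
  by move=> jN; rewrite natrB// mulrBl divff// pnatr_eq0.
set x := N.+1%:R^-1 in x_gt0 x_eq N_e1 tail_lim.
have ind01 n v : 0 <= ((a <= U n v)%R%:R : R) <= 1.
  by rewrite ler0n lern1 leq_b1.
have tail01 j n v : 0 <= bernstein_tail N j (U n v) <= 1.
  by rewrite bernstein_tail_ge0 ?bernstein_tail_le1.
have upper : \forall n \near \oo, L n (fun v => (a <= U n v)%R%:R) <= 1 - a + 5 * e.
  have [ae|ea] := ltP a e.
    near=> n; apply: (@le_trans _ _ 1); last by lra.
    rewrite -[leRHS](L_cst n); apply: L_mono; [exact: bddI|exact: bdd_cst|].
    by move=> v; have /andP[] := ind01 n v.
  (* A threshold slightly below a: the tail is nearly 1 wherever U >= a. For a < e there is no room
     below a, and the trivial bound 1 was enough. *)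
  pose j := Num.truncn (N%:R * (a - e)).
  have Nae : 0 <= N%:R * (a - e) by rewrite mulr_ge0 ?ler0n// subr_ge0.
  have /andP[j1 j2] := truncn_itv Nae; rewrite -/j in j1 j2.
  have jN : (j <= N.+1)%N.
    rewrite -(ler_nat R) (le_trans j1)// -natr1.
    have : N%:R * (a - e) <= N%:R * 1 by rewrite ler_wpM2l ?ler0n//; lra.
    by lra.
  have /cvgrPdist_le/(_ _ e0) T := bernstein_tail_moment jN.
  near=> n.
  have : `|(N.+1 - j)%:R / N.+1%:R - L n (fun v => bernstein_tail N j (U n v))| <= e by near: n.
  have : (N.+1 - j)%:R / N.+1%:R <= 1 - a + e + 2 * x :> R.
    rewrite tail_lim//.
    have : N%:R * (a - e) * x <= (j%:R + 1) * x.
      by rewrite ler_pM2r// natr1 ltW.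
    have -> : N%:R * (a - e) * x = (a - e) * (1 - x) by rewrite -x_eq; ring.
    nra.
  have : L n (fun v => (a <= U n v)%R%:R) <=
      L n (fun v => bernstein_tail N j (U n v)) + (N%:R * e ^+ 2)^-1.
    rewrite -[X in _ + X](L_cst n) -L_add; [|exact: bddI|exact: bdd_cst].
    apply: L_mono; [exact: bddI|apply: bdd_add; [exact: bddI|exact: bdd_cst]|].
    move=> v; have [aU|_] := leP a (U n v).
      rewrite mulr1n; apply: bernstein_tail_lower => //.
      apply: (@le_trans _ _ (N%:R * a)); last by rewrite ler_pM2l.
      by lra.
    by rewrite mulr0n addr_ge0 ?bernstein_tail_ge0// invr_ge0 mulr_ge0 ?ler0n// exprn_ge0// ltW.
  rewrite ler_norml => h1 h2 /andP[h3 h4].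
  have h5 : L n (fun v => (a <= U n v)%R%:R) <=
      L n (fun v => bernstein_tail N j (U n v)) + e.
    by apply: le_trans h1 _; rewrite lerD2l.
  move: h2 h3 h5 N_e1; set T1 := L n _; set T2 := L n _; set T3 := (N.+1 - j)%:R * x.
  by clearbody T1 T2 T3 x e; lra.
have lower : \forall n \near \oo, 1 - a - 5 * e <= L n (fun v => (a <= U n v)%R%:R).
  have [ae|ea] := ltP 1 (a + e).
    near=> n; apply: (@le_trans _ _ 0); first by lra.
    rewrite -[leLHS](L_cst n); apply: L_mono; [exact: bdd_cst|exact: bddI|].
    by move=> v; have /andP[] := ind01 n v.
  (* A threshold slightly above a: the tail is nearly 0 wherever U < a. *)
  pose j := (Num.truncn (N%:R * (a + e))).+1.
  have Nae : 0 <= N%:R * (a + e) by rewrite mulr_ge0 ?ler0n//; lra.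
  have /andP[j1 j2] := truncn_itv Nae; rewrite -/j in j2.
  have jN : (j <= N.+1)%N.
    rewrite ltnS -(ler_nat R) (le_trans j1)//.
    by rewrite -[leRHS]mulr1 ler_wpM2l ?ler0n.
  have /cvgrPdist_le/(_ _ e0) T := bernstein_tail_moment jN.
  near=> n.
  have : `|(N.+1 - j)%:R / N.+1%:R - L n (fun v => bernstein_tail N j (U n v))| <= e by near: n.
  have : 1 - a - e - x <= (N.+1 - j)%:R / N.+1%:R :> R.
    rewrite tail_lim//.
    have : j%:R * x <= (N%:R * (a + e) + 1) * x.
      by rewrite ler_pM2r// -natr1 lerD2r.
    have -> : (N%:R * (a + e) + 1) * x = (a + e) * (1 - x) + x by rewrite -x_eq; ring.
    nra.
  have : L n (fun v => bernstein_tail N j (U n v)) <=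
      L n (fun v => (a <= U n v)%R%:R) + (N%:R * e ^+ 2)^-1.
    rewrite -[X in _ + X](L_cst n) -L_add; [|exact: bddI|exact: bdd_cst].
    apply: L_mono; [exact: bddI|apply: bdd_add; [exact: bddI|exact: bdd_cst]|].
    move=> v; have [aU|Ua] := leP a (U n v).
      rewrite mulr1n (le_trans (bernstein_tail_le1 _ _ _))// lerDl invr_ge0.
      by rewrite mulr_ge0 ?ler0n// exprn_ge0// ltW.
    rewrite mulr0n add0r; apply: bernstein_tail_upper => //.
    rewrite -mulrDr (le_trans _ (ltW j2))// ler_pM2l//; lra.
  rewrite ler_norml => h1 h2 /andP[h3 h4].
  have h5 : L n (fun v => bernstein_tail N j (U n v)) <=
      L n (fun v => (a <= U n v)%R%:R) + e.
    by apply: le_trans h1 _; rewrite lerD2l.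
  move: h2 h4 h5 N_e1; set T1 := L n _; set T2 := L n _; set T3 := (N.+1 - j)%:R * x.
  by clearbody T1 T2 T3 x e; lra.
near=> n; rewrite ler_norml.
have : L n (fun v => (a <= U n v)%R%:R) <= 1 - a + 5 * e by near: n.
have : 1 - a - 5 * e <= L n (fun v => (a <= U n v)%R%:R) by near: n.
lra.
Unshelve. all: by end_near. Qed.

End karamata.

(** * Independence and the branching recursion *)

Section nat_valued.
Local Open Scope ereal_scope.
Context (d : measure_display) (T : measurableType d) (R : realType).
Variable P : probability T R.

Lemma measurable_fun_nat (Y : T -> nat) :
  (forall k, measurable (Y @^-1` [set k])) -> measurable_fun [set: T] Y.
Proof.
move=> mY _ A _; rewrite setTI.
have -> : Y @^-1` A = \bigcup_(k in A) (Y @^-1` [set k]).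
  by apply/seteqP; split => [w Aw|w [k Ak /= wk]]; [by exists (Y w)|by rewrite /preimage/= wk].
exact: bigcup_measurable.
Qed.

Lemma measurable_EFin_nat (E : set T) (Y : T -> nat) (h : nat -> R) :
  measurable_fun [set: T] Y -> measurable_fun E (fun w => (h (Y w))%:E).
Proof.
move=> mY; apply: (@measurable_funS _ _ _ _ setT) => //.
apply/measurable_EFinP; apply: (measurableT_comp _ mY).
by [].
Qed.

Lemma integral_fibers (E : set T) (Y : T -> nat) (f : T -> \bar R) :
  measurable E -> measurable_fun [set: T] Y -> measurable_fun E f ->
  (forall w, 0 <= f w) ->
  \int[P]_(w in E) f w = \sum_(k <oo) \int[P]_(w in E `&` Y @^-1` [set k]) f w.
Proof.
move=> mE mY mf f0.
have EE : E = \bigcup_k (E `&` Y @^-1` [set k]).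
  by rewrite -setI_bigcupr; apply/seteqP; split => [w Ew|w []//]; split => //; exists (Y w).
rewrite {1}EE ge0_integral_bigcup//.
- by move=> k; apply: measurableI => //; rewrite -[X in measurable X]setTI; exact: mY.
- by rewrite -EE.
- by move=> i j _ _ [w [[_ <-] [_ <-]]].
Qed.

Lemma integral_nat (E : set T) (Y : T -> nat) (h : nat -> R) :
  measurable E -> measurable_fun [set: T] Y -> (forall k, (0 <= h k)%R) ->
  \int[P]_(w in E) (h (Y w))%:E = \sum_(k <oo) (h k)%:E * P (E `&` Y @^-1` [set k]).
Proof.
move=> mE mY h0.
rewrite (integral_fibers mE mY)//; [|exact: measurable_EFin_nat|by move=> w; rewrite lee_fin].
apply: eq_eseriesr => k _.
have mk : measurable (E `&` Y @^-1` [set k]).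
  by apply: measurableI => //; rewrite -[X in measurable X]setTI; exact: mY.
rewrite (@eq_integral _ _ _ _ _ (cst (h k)%:E)); last first.
  by move=> w; rewrite inE => -[_ /= ->].
by rewrite integral_cst.
Qed.

(** Splitting along the fibres of [Y] and then of [Y'] gives a double series of nonnegative terms in
    which the joint probabilities factor. *)
Lemma integral_indep_prod (E : set T) (Y Y' : T -> nat) (h h' : nat -> R) (c : R) :
  measurable E -> measurable_fun [set: T] Y -> measurable_fun [set: T] Y' ->
  (forall a b, P (E `&` Y @^-1` [set a] `&` Y' @^-1` [set b]) =
               P (E `&` Y @^-1` [set a]) * P (Y' @^-1` [set b])) ->
  (forall k, (0 <= h k)%R) -> (forall k, (0 <= h' k)%R) ->
  \int[P]_w (h' (Y' w))%:E = c%:E ->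
  \int[P]_(w in E) (h (Y w) * h' (Y' w))%:E =
  c%:E * \int[P]_(w in E) (h (Y w))%:E.
Proof.
move=> mE mY mY' ind h0 h'0 intc.
have mk k : measurable (E `&` Y @^-1` [set k]).
  by apply: measurableI => //; rewrite -[X in measurable X]setTI; exact: mY.
rewrite (integral_fibers mE mY)//; last 2 first.
- apply/measurable_EFinP; apply: measurable_funM; apply/measurable_EFinP;
    exact: measurable_EFin_nat.
- by move=> w; rewrite lee_fin mulr_ge0.
rewrite integral_nat// -nneseriesZl; last by move=> k _; rewrite mule_ge0// lee_fin.
apply: eq_eseriesr => k _.
rewrite (@eq_integral _ _ _ _ _ (fun w => (h k)%:E * (h' (Y' w))%:E)); last first.
  by move=> w; rewrite inE => -[_ /= ->]; rewrite EFinM.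
rewrite ge0_integralZl_EFin//; last 2 first.
- by move=> w _; rewrite lee_fin.
- exact: measurable_EFin_nat.
rewrite integral_nat//; under eq_eseriesr do rewrite ind muleCA.
rewrite -[P (E `&` _)]fineK ?fin_num_measure// nneseriesZl; last first.
  by move=> b _; rewrite mule_ge0// lee_fin.
have := integral_nat measurableT mY' h'0; rewrite intc.
under eq_eseriesr do rewrite setTI; move=> <-.
rewrite [in RHS]muleC -muleA; congr (_ * _).
Qed.

End nat_valued.

Section independence.
Local Open Scope ereal_scope.
Context (d : measure_display) (T : measurableType d) (R : realType).
Variable P : probability T R.
Context (I : choiceType) (X : I -> {RV P >-> nat}).
Hypothesis X_indep : mutually_independent X.

(* The event [E] is independent of the family of the [X i] with [i] outside [J]. *)
Definition indep_outside (J : set I) (E : set T) := measurable E /\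
  forall (s : seq I) (B : I -> set nat), uniq s -> (forall i, i \in s -> ~ J i) ->
    P (E `&` \bigcap_(i in [set` s]) X i @^-1` B i) =
    P E * \prod_(i <- s) P (X i @^-1` B i).

Lemma measurable_RV_nat i (A : set nat) : measurable (X i @^-1` A).
Proof. by rewrite -[X in measurable X]setTI; exact: measurable_funPT. Qed.

Lemma indep_outsideT : indep_outside set0 setT.
Proof.
by split=> // s B us _; rewrite setTI probability_setT mul1e X_indep.
Qed.

Lemma indep_outside0 J : indep_outside J set0.
Proof. by split=> // s B us _; rewrite set0I !measure0 mul0e. Qed.

Lemma indep_outsideS J J' E : J `<=` J' -> indep_outside J E -> indep_outside J' E.
Proof.
by move=> JJ' [mE EJ]; split=> // s B us sJ; apply: EJ => // i /sJ /(contra_not (@JJ' i)).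
Qed.

Lemma indep_outside_event J E i (A : set nat) : indep_outside J E -> ~ J i ->
  P (E `&` X i @^-1` A) = P E * P (X i @^-1` A).
Proof.
move=> [mE EJ] Ji; have := EJ [:: i] (fun=> A) isT.
rewrite set_cons1 bigcap_set1 big_seq1; apply => j; rewrite inE => /eqP ->.
exact: Ji.
Qed.

(** With [indep_outside_bigcup], this closure property replaces generated sigma-algebras: every
    event about Z_n is built from fresh coordinates and countable disjoint unions. *)
Lemma indep_outsideI J E i (A : set nat) : indep_outside J E -> ~ J i ->
  indep_outside (i |` J) (E `&` X i @^-1` A).
Proof.
move=> EJ Ji; have [mE EJ'] := EJ; split.
  by apply: measurableI => //; exact: measurable_RV_nat.
move=> s B us sJ; rewrite (indep_outside_event _ EJ)//.
have is_ : i \notin s by apply/negP => /sJ; apply; left.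
(* The independence of E is applied to the enlarged list i :: s, with A imposed at i. *)
pose B' j := if j == i then A else B j.
have := EJ' (i :: s) B' _ _; rewrite /= is_ us.
have -> : [set` i :: s] = i |` [set` s].
  apply/seteqP; split => j /=; rewrite inE.
    by case/orP => [/eqP|]; [left|right].
  by case=> [->|->]; rewrite ?eqxx ?orbT.
have B'i : B' i = A by rewrite /B' eqxx.
have B's j : j \in s -> B' j = B j.
  by rewrite /B'; case: eqP => // -> si; rewrite si in is_.
rewrite bigcap_setU1 big_cons B'i setIA muleA => H.
have -> : \bigcap_(j in [set` s]) X j @^-1` B j = \bigcap_(j in [set` s]) X j @^-1` B' j.
  by apply: eq_bigcapr => j /= js; rewrite B's.
rewrite H//; last by move=> j; rewrite inE => /orP[/eqP ->//|/sJ h Jj]; apply: h; right.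
by congr (_ * _); apply: eq_big_seq => j js; rewrite B's.
Qed.

Lemma indep_outside_bigcup J (E : nat -> set T) : trivIset setT E ->
  (forall k, indep_outside J (E k)) -> indep_outside J (\bigcup_k E k).
Proof.
move=> tE EJ; split; first by apply: bigcup_measurable => k _; exact: (EJ k).1.
move=> s B us sJ; rewrite setI_bigcupl.
have mF : measurable (\bigcap_(i in [set` s]) X i @^-1` B i).
  by apply: fin_bigcap_measurable => [|i _]; [exact: finite_seq|exact: measurable_RV_nat].
rewrite measure_semi_bigcup; last 3 first.
- by move=> k; apply: measurableI => //; exact: (EJ k).1.
- by move=> i j _ _ [w [[Ei _] [Ej _]]]; apply: tE => //; exists w.
- by apply: bigcup_measurable => k _; apply: measurableI => //; exact: (EJ k).1.
rewrite measure_semi_bigcup//; last 2 first.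
- by move=> k; exact: (EJ k).1.
- by apply: bigcup_measurable => k _; exact: (EJ k).1.
rewrite (eq_eseriesr (g := fun k => (\prod_(i <- s) P (X i @^-1` B i)) * P (E k))); last first.
  by move=> k _; rewrite muleC; exact: (EJ k).2.
have : \prod_(i <- s) P (X i @^-1` B i) \is a fin_num.
  elim/big_rec: _ => // i x _ xfin; rewrite fin_numM// fin_num_measure//.
  exact: measurable_RV_nat.
by move=> /fineK <-; rewrite nneseriesZl 1?muleC.
Qed.

End independence.

(** Coefficientwise domination of nonnegative polynomials survives powers. The case Q = q yields
    nonnegativity alone; a Q built from uniform moment bounds yields estimates uniform in the
    generation. *)
Lemma coef_exp_bounds (R : realDomainType) (q Q : {poly R}) :
  (forall k, (0 <= q`_k <= Q`_k)%R) -> forall l j, (0 <= (q ^+ l)`_j <= (Q ^+ l)`_j)%R.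
Proof.
move=> qQ; elim=> [|l IH] j; first by rewrite !expr0 lexx coef1 ler0n.
rewrite !exprS !coefM; apply/andP; split.
  apply: sumr_ge0 => i _.
  by rewrite mulr_ge0//; [have /andP[] := qQ i|have /andP[] := IH (j - i)%N].
apply: ler_sum => i _; have /andP[? ?] := qQ i.
by have /andP[? ?] := IH (j - i)%N; exact: ler_pM.
Qed.

(** With 1 + u q(u) in the role of E((1 + u)^X), this writes the binomial moments of a sum of i
    offspring counts as combinations of the binomial coefficients of i. *)
Lemma coef_binomial_exp (R : comNzRingType) (q : {poly R}) (i r : nat) :
  (((1 + 'X * q) ^+ i)`_r = \sum_(l < r.+1) 'C(i, l)%:R * (q ^+ l)`_(r - l))%R.
Proof.
rewrite exprDn coef_sum.
(* Both sums are padded to the range i + r + 1; the guard is needed because r - l is truncated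
   subtraction. *)
pose F l := ('C(i, l)%:R * (if (r < l)%N then 0 else (q ^+ l)`_(r - l)))%R.
transitivity (\sum_(l < (i + r).+1) F l)%R; last first.
  rewrite [RHS](big_ord_widen (i + r).+1
    (fun l => 'C(i, l)%:R * (q ^+ l)`_(r - l))%R) ?ltnS ?leq_addl//.
  rewrite [RHS]big_mkcond/=; apply: eq_bigr => l _; rewrite /F ltnS.
  by case: leqP => _ /=; rewrite ?mulr0.
transitivity (\sum_(l < i.+1) F l)%R.
  by apply: eq_bigr => l _; rewrite expr1n mul1r exprMn coefMn coefXnM -mulr_natl.
rewrite (big_ord_widen (i + r).+1 F) ?ltnS ?leq_addr// big_mkcond/=.
by apply: eq_bigr => l _; rewrite /F; case: ltnP => // il; rewrite bin_small// mul0r.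
Qed.

Section branching_process.
Local Open Scope ereal_scope.
Context (d : measure_display) (T : measurableType d) (R : realType).
Variable P : probability T R.
Variable xi : nat -> nat -> {RV P >-> nat}.
Hypothesis xi_indep : mutually_independent (fun nj : nat * nat => xi nj.1 nj.2).
Let Z := branching (fun n j => (xi n j : T -> nat)).

Let S n i (w : T) : nat := (\sum_(j < i) xi n j w)%N.

Let before n : set (nat * nat) := [set c | (c.1 < n)%N].
Let before2 n i : set (nat * nat) := [set c | (c.1 < n)%N \/ c.1 = n /\ (c.2 < i)%N].

Local Notation indep := (indep_outside (fun nj : nat * nat => xi nj.1 nj.2)).

(** Splitting the next sum along the value b of the current one makes each piece the intersection of
    an event already revealed with a condition on the single new coordinate (n, i). *)
Lemma indep_partial_sum n l i a : indep (before n) (Z n @^-1` [set l]) ->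
  indep (before2 n i) (Z n @^-1` [set l] `&` S n i @^-1` [set a]).
Proof.
move=> indZ; elim: i a => [|i IH] a.
  apply: (@indep_outsideS _ _ _ _ _ _ (before n)); first by move=> c; left.
  have [->|a0] := eqVneq a 0%N.
    rewrite (_ : S n 0 @^-1` _ = setT) ?setIT//.
    by apply/seteqP; split => // w _; rewrite /S/= big_ord0.
  rewrite (_ : _ `&` _ = set0); first exact: indep_outside0.
  by apply/seteqP; split => // w [_]; rewrite /S/= big_ord0 => /esym/eqP; rewrite (negPf a0).
have -> : Z n @^-1` [set l] `&` S n i.+1 @^-1` [set a] =
    \bigcup_b (Z n @^-1` [set l] `&` S n i @^-1` [set b] `&`
      xi n i @^-1` [set x | (b + x)%N = a]).
  apply/seteqP; split => [w [Zw]|w [b _ [[Zw Sw] xw]]].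
    rewrite /S/= big_ord_recr/= => Sa; exists (S n i w) => //.
  by split => //; rewrite /S/= big_ord_recr/= -[X in (X + _)%N]/(S n i w) Sw.
apply: indep_outside_bigcup => [j k _ _ [w [[[_ /= <-] _] [[_ /= <-] _]]]//|b].
apply: (@indep_outsideS _ _ _ _ _ _ ((n, i) |` before2 n i)).
  move=> c [->|[h|[h1 h2]]]; [by right|by left|by right; split => //; exact: ltnW].
apply: (indep_outsideI (X := fun nj : nat * nat => xi nj.1 nj.2) (i := (n, i)) _ (IH b)) => //=.
by move=> [/=|[_]]; rewrite ltnn.
Qed.

(** On the event Z_n = k the random sum has a fixed number k of terms, so it is a partial sum
    [S n k]. *)
Lemma indep_branching n l : indep (before n) (Z n @^-1` [set l]).
Proof.
elim: n l => [|n IH] l.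
  apply: (@indep_outsideS _ _ _ _ _ _ set0) => //.
  have [->|l1] := eqVneq l 1%N.
    rewrite (_ : _ @^-1` _ = setT); first exact: indep_outsideT.
    by apply/seteqP; split.
  rewrite (_ : _ @^-1` _ = set0); first exact: indep_outside0.
  by apply/seteqP; split => // w /esym/eqP; rewrite (negPf l1).
have -> : Z n.+1 @^-1` [set l] =
    \bigcup_k (Z n @^-1` [set k] `&` S n k @^-1` [set l]).
  by apply/seteqP; split => [w Zw|w [k _ [/= <-]]//]; exists (Z n w).
apply: indep_outside_bigcup => [j k _ _ [w [[/= <- _] [/= <- _]]]//|k].
apply: indep_outsideS; last exact: indep_partial_sum (IH k).
by move=> c [h|[h _]]; rewrite /before/= ltnS ?h//; exact: ltnW.
Qed.

Lemma measurable_branching n : measurable_fun [set: T] (Z n).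
Proof. by apply: measurable_fun_nat => k; exact: (indep_branching n k).1. Qed.

Lemma measurable_partial_sum n i : measurable_fun [set: T] (S n i).
Proof.
elim: i => [|i IH].
  by rewrite (_ : S n 0 = cst 0%N)//; apply/funext => w; rewrite /S big_ord0.
rewrite (_ : S n i.+1 = fun w => (S n i w + xi n i w)%N).
  exact: measurable_fun_addn.
by apply/funext => w; rewrite /S big_ord_recr.
Qed.

(** One generation is integrated event by event: where Z_n = l, the next generation is [S n l], with
    a deterministic number of summands. *)
Lemma integral_branchingS n (h H : nat -> R) :
  (forall k, (0 <= h k)%R) -> (forall k, (0 <= H k)%R) ->
  (forall l, \int[P]_(w in Z n @^-1` [set l]) (h (S n l w))%:E =
     (H l)%:E * P (Z n @^-1` [set l])) ->
  \int[P]_w (h (Z n.+1 w))%:E = \int[P]_w (H (Z n w))%:E.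
Proof.
move=> h0 H0 hH.
rewrite (integral_fibers P measurableT (measurable_branching n))//; last 2 first.
- exact/measurable_EFin_nat/measurable_branching.
- by move=> w; rewrite lee_fin.
rewrite integral_nat//; last exact: measurable_branching.
apply: eq_eseriesr => l _; rewrite !setTI -hH; apply: eq_integral => w.
by rewrite inE /S /= => <-.
Qed.

Lemma integral_partial_sumS n l i (h h' : nat -> R) (c : R) :
  (forall k, (0 <= h k)%R) -> (forall k, (0 <= h' k)%R) ->
  \int[P]_w (h' (xi n i w))%:E = c%:E ->
  \int[P]_(w in Z n @^-1` [set l]) (h (S n i w) * h' (xi n i w))%:E =
  c%:E * \int[P]_(w in Z n @^-1` [set l]) (h (S n i w))%:E.
Proof.
move=> h0 h'0 hc; apply: integral_indep_prod => //.
- exact: (indep_branching n l).1.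
- exact: measurable_partial_sum.
- move=> a b.
  apply: (indep_outside_event (X := fun nj : nat * nat => xi nj.1 nj.2) (i := (n, i)) _
    (indep_partial_sum i a (indep_branching n l))).
  by move=> [/=|[_]]; rewrite ltnn.
Qed.

Lemma integral_partial_sum0 n l (h : nat -> R) : (0 <= h 0%N)%R ->
  \int[P]_(w in Z n @^-1` [set l]) (h (S n 0 w))%:E = (h 0%N)%:E * P (Z n @^-1` [set l]).
Proof.
move=> h0; rewrite -integral_cst; last exact: (indep_branching n l).1.
by apply: eq_integral => w _; rewrite /S big_ord0.
Qed.

Lemma integral_branching_pgf n (u c : R) : (0 <= u)%R ->
  (forall j, \int[P]_w (u ^+ xi n j w)%:E = c%:E) ->
  \int[P]_w (u ^+ Z n.+1 w)%:E = \int[P]_w (c ^+ Z n w)%:E.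
Proof.
move=> u0 uc.
have c0 : (0 <= c)%R.
  by rewrite -lee_fin -(uc 0%N); apply: integral_ge0 => w _; rewrite lee_fin exprn_ge0.
apply: (integral_branchingS (h := fun k => (u ^+ k)%R) (H := fun k => (c ^+ k)%R)).
- by move=> k; rewrite exprn_ge0.
- by move=> k; rewrite exprn_ge0.
(* Only the number of summands varies in the induction; the conditioning event keeps its l. *)
move=> l; elim: {2 3}l => [|i IH].
  by rewrite (integral_partial_sum0 _ _ (h := fun k => (u ^+ k)%R)).
under eq_integral => w _ do rewrite /S big_ord_recr/= exprD -[X in (_ ^+ X * _)%R]/(S n i w).
rewrite (integral_partial_sumS (h := fun k => (u ^+ k)%R) (h' := fun k => (u ^+ k)%R) _ _ _ (uc i)).
- by rewrite IH muleA -EFinM exprS.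
- by move=> k; rewrite exprn_ge0.
- by move=> k; rewrite exprn_ge0.
Qed.

(** Vandermonde's identity turns the addition of one independent summand into a polynomial product.
    Truncating the polynomial at degree N is harmless, as only coefficients up to r <= N enter. *)
Lemma integral_partial_sum_bin n l i r N (e : nat -> R) :
  (forall k, (0 <= e k)%R) ->
  (forall j k, (k <= N)%N -> \int[P]_w ('C(xi n j w, k)%:R)%:E = (e k)%:E) -> (r <= N)%N ->
  \int[P]_(w in Z n @^-1` [set l]) ('C(S n i w, r)%:R)%:E =
    (((\poly_(k < N.+1) e k) ^+ i)`_r)%:E * P (Z n @^-1` [set l]).
Proof.
move=> e0 eN; elim: i r => [|i IH] r rN.
  rewrite (integral_partial_sum0 _ _ (h := fun k => ('C(k, r)%:R)%R))//.
  by rewrite expr0 coef1 bin0n.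
transitivity (\int[P]_(w in Z n @^-1` [set l])
    (\sum_(t <- index_enum 'I_r.+1) ('C(S n i w, t)%:R * 'C(xi n i w, r - t)%:R)%:E)).
  apply: eq_integral => w _; rewrite /S big_ord_recr/= -binomial.Vandermonde natr_sum -sumEFin.
  by apply: eq_bigr => t _; rewrite natrM.
rewrite ge0_integral_sum//; last 2 first.
- exact: (indep_branching n l).1.
- move=> t; apply/measurable_EFinP; apply: measurable_funM; apply/measurable_EFinP.
    by apply: (measurable_EFin_nat (fun k => ('C(k, t)%:R)%R)); exact: measurable_partial_sum.
  exact: (measurable_EFin_nat (fun k => ('C(k, r - t)%:R)%R)).
rewrite exprSr coefM -sumEFin ge0_sume_distrl; last first.
  have e01 k : (0 <= (\poly_(k < N.+1) e k)`_k <= (\poly_(k < N.+1) e k)`_k)%R.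
    by rewrite lexx andbT coef_poly; case: ifP.
  move=> t _; rewrite lee_fin mulr_ge0//; last by have /andP[] := e01 (r - t)%N.
  by have /andP[] := coef_exp_bounds e01 i t.
apply: eq_bigr => t _.
have tr : (t <= r)%N by rewrite -ltnS.
rewrite (integral_partial_sumS (h := fun k => ('C(k, t)%:R)%R) (h' := fun k => ('C(k, r - t)%:R)%R)
  _ _ _ (eN i (r - t)%N _))//; last by rewrite (leq_trans (leq_subr _ _)).
rewrite IH ?(leq_trans tr)// muleA -EFinM [in RHS]coef_poly ltnS.
by rewrite (leq_trans (leq_subr _ _) rN) mulrC.
Qed.

Lemma integral_branching_bin n r N (e : nat -> R) :
  (forall k, (0 <= e k)%R) -> e 0%N = 1%R ->
  (forall j k, (k <= N)%N -> \int[P]_w ('C(xi n j w, k)%:R)%:E = (e k)%:E) -> (r <= N)%N ->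
  \int[P]_w ('C(Z n.+1 w, r)%:R)%:E =
    \sum_(l < r.+1) (((\poly_(k < N) e k.+1) ^+ l)`_(r - l))%:E *
      \int[P]_w ('C(Z n w, l)%:R)%:E.
Proof.
move=> e0 e1 eN rN; set q := \poly_(k < N) e k.+1.
have q0 l j : (0 <= (q ^+ l)`_j)%R.
  have qq k : (0 <= q`_k <= q`_k)%R by rewrite lexx andbT coef_poly; case: ifP.
  by have /andP[] := coef_exp_bounds qq l j.
have polyE : (\poly_(k < N.+1) e k = 1 + 'X * q)%R.
  apply/polyP => -[|k]; rewrite coef_poly coefD coef1 coefXM/=; first by rewrite e1 addr0.
  by rewrite coef_poly ltnS add0r.
pose H i := (\sum_(l < r.+1) 'C(i, l)%:R * (q ^+ l)`_(r - l))%R.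
rewrite (integral_branchingS (h := fun k => ('C(k, r)%:R)%R) (H := H))//; last 2 first.
- by move=> i; apply: sumr_ge0 => l _; rewrite mulr_ge0.
- by move=> l; rewrite (integral_partial_sum_bin _ _ e0 eN)// polyE coef_binomial_exp.
transitivity (\int[P]_w \sum_(l <- index_enum 'I_r.+1)
    ((((q ^+ l)`_(r - l))%R)%:E * ('C(Z n w, l)%:R)%:E)).
  apply: eq_integral => w _; rewrite -sumEFin; apply: eq_bigr => l _.
  by rewrite mulrC EFinM.
rewrite ge0_integral_sum//; last first.
- by move=> l w _; rewrite mule_ge0 ?lee_fin.
- move=> l; apply/measurable_EFinP; apply: measurable_funM => //; apply/measurable_EFinP.
  exact: (measurable_EFin_nat (fun k => ('C(k, l)%:R)%R) (measurable_branching n)).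
apply: eq_bigr => l _; rewrite ge0_integralZl_EFin//.
exact: (measurable_EFin_nat (fun k => ('C(k, l)%:R)%R) (measurable_branching n)).
Qed.

End branching_process.

(** * Offspring laws *)

Section nat_expectation.
Context (d : measure_display) (T : measurableType d) (R : realType).
Context (P : probability T R) (Y : {RV P >-> nat}).

Definition nat_mean (h : nat -> R) : R := fine (\int[P]_w (h (Y w))%:E).

Definition nat_summable (h : nat -> R) :=
  (forall k, 0 <= h k) /\ (\int[P]_w (h (Y w))%:E < +oo)%E.

Let mY : measurable_fun [set: T] Y := measurable_funPT Y.

Lemma nat_meanE h : nat_summable h -> (\int[P]_w (h (Y w))%:E = (nat_mean h)%:E)%E.
Proof.
move=> [h0 hoo]; rewrite fineK// ge0_fin_numE//.
by apply: integral_ge0 => w _; rewrite lee_fin.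
Qed.

Lemma nat_mean_ge0 h : nat_summable h -> 0 <= nat_mean h.
Proof.
move=> hs; rewrite -lee_fin -nat_meanE//; apply: integral_ge0 => w _.
by rewrite lee_fin hs.1.
Qed.

Lemma nat_summable_le h h' : (forall k, 0 <= h k <= h' k) -> nat_summable h' ->
  nat_summable h /\ nat_mean h <= nat_mean h'.
Proof.
move=> hh' hs'.
have h0 k : 0 <= h k by have /andP[] := hh' k.
have le : (\int[P]_w (h (Y w))%:E <= \int[P]_w (h' (Y w))%:E)%E.
  apply: ge0_le_integral => //.
  - by move=> w _; rewrite lee_fin.
  - exact: measurable_EFin_nat.
  - exact: measurable_EFin_nat.
  - by move=> w _; rewrite lee_fin; have /andP[] := hh' (Y w).
have hs : nat_summable h by split=> //; exact: le_lt_trans le hs'.2.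
by split=> //; rewrite -lee_fin -!nat_meanE.
Qed.

Lemma nat_summableD h h' : nat_summable h -> nat_summable h' ->
  nat_summable (fun k => h k + h' k) /\
  nat_mean (fun k => h k + h' k) = nat_mean h + nat_mean h'.
Proof.
move=> hs hs'.
have E : (\int[P]_w (h (Y w) + h' (Y w))%:E = (nat_mean h + nat_mean h')%:E)%E.
  rewrite EFinD -!nat_meanE// -ge0_integralD//.
  - by move=> w _; rewrite lee_fin hs.1.
  - exact: measurable_EFin_nat.
  - by move=> w _; rewrite lee_fin hs'.1.
  - exact: measurable_EFin_nat.
split; last by rewrite /nat_mean E.
by split; [move=> k; rewrite addr_ge0 ?hs.1 ?hs'.1|rewrite E ltry].
Qed.

Lemma nat_summableZ c h : 0 <= c -> nat_summable h ->
  nat_summable (fun k => c * h k) /\ nat_mean (fun k => c * h k) = c * nat_mean h.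
Proof.
move=> c0 hs.
have E : (\int[P]_w (c * h (Y w))%:E = (c * nat_mean h)%:E)%E.
  rewrite EFinM -nat_meanE// -ge0_integralZl_EFin//.
  - by move=> w _; rewrite lee_fin hs.1.
  - exact: measurable_EFin_nat.
split; last by rewrite /nat_mean E.
by split; [move=> k; rewrite mulr_ge0 ?hs.1|rewrite E ltry].
Qed.

Lemma nat_summable_indic (A : pred nat) :
  nat_summable (fun k => (A k)%:R) /\
  (P [set w | A (Y w)] = (nat_mean (fun k => (A k)%:R))%:E)%E.
Proof.
have mA : measurable [set w | A (Y w)].
  by rewrite -[X in measurable X]setTI; exact: (mY measurableT (Y := [set k | A k])).
have E : (\int[P]_w ((A (Y w))%:R%:E) = P [set w | A (Y w)])%E.
  rewrite -[in RHS](setIT [set w | _]) -integral_indic//; apply: eq_integral => w _.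
  by rewrite indicE mem_setE.
have hs : nat_summable (fun k => (A k)%:R).
  by split=> //; rewrite E ltey_eq fin_num_measure.
by split=> //; rewrite -nat_meanE.
Qed.

Lemma nat_summable_cst c : 0 <= c -> nat_summable (fun=> c) /\ nat_mean (fun=> c) = c.
Proof.
move=> c0; have E : (\int[P]_w c%:E = c%:E)%E.
  by rewrite integral_cst//= [P _]probability_setT mule1.
by split; [split=> //; rewrite E ltry|rewrite /nat_mean E].
Qed.

End nat_expectation.

(** * Expansion of generating functions at 1 *)

Section power_sums.
Context (R : realFieldType).

(* The identities below expand s^k around s = 1, with nonnegative remainders. *)
Definition psum1 (s : R) (k : nat) : R := \sum_(i < k) s ^+ i.
Definition psum2 (s : R) (k : nat) : R := \sum_(i < k) psum1 s i.
Definition psum3 (s : R) (k : nat) : R := \sum_(i < k) psum2 s i.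

Lemma psum1S s k : psum1 s k.+1 = psum1 s k + s ^+ k.
Proof. by rewrite /psum1 big_ord_recr. Qed.
Lemma psum2S s k : psum2 s k.+1 = psum2 s k + psum1 s k.
Proof. by rewrite /psum2 big_ord_recr. Qed.
Lemma psum3S s k : psum3 s k.+1 = psum3 s k + psum2 s k.
Proof. by rewrite /psum3 big_ord_recr. Qed.

Lemma psum1E s k : s ^+ k + (1 - s) * psum1 s k = 1.
Proof.
elim: k => [|k IH]; first by rewrite /psum1 big_ord0 mulr0 addr0.
rewrite -[RHS]IH psum1S exprS; ring.
Qed.

Lemma psum2E s k : psum1 s k + (1 - s) * psum2 s k = k%:R.
Proof.
elim: k => [|k IH]; first by rewrite /psum1 /psum2 !big_ord0 mulr0 addr0.
rewrite -natr1 -IH -[X in _ = _ + X](psum1E s k) psum1S psum2S; ring.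
Qed.

Lemma psum3E s k : psum2 s k + (1 - s) * psum3 s k = k%:R * (k%:R - 1) / 2.
Proof.
elim: k => [|k IH]; first by rewrite /psum2 /psum3 !big_ord0 !mul0r mulr0 addr0.
rewrite psum2S psum3S -natr1.
have -> : (k%:R + 1) * (k%:R + 1 - 1) / 2 = k%:R * (k%:R - 1) / 2 + k%:R :> R by field.
rewrite -IH -[X in _ = _ + X](psum2E s k); ring.
Qed.

Section bounds.
Variables (s : R) (s01 : 0 <= s <= 1).
Let s0 : 0 <= s. Proof. by case/andP: s01. Qed.
Let s1 : 0 <= 1 - s. Proof. by rewrite subr_ge0; case/andP: s01. Qed.

Lemma psum1_ge0 k : 0 <= psum1 s k.
Proof. by apply: sumr_ge0 => i _; rewrite exprn_ge0. Qed.
Lemma psum2_ge0 k : 0 <= psum2 s k.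
Proof. by apply: sumr_ge0 => i _; exact: psum1_ge0. Qed.
Lemma psum3_ge0 k : 0 <= psum3 s k.
Proof. by apply: sumr_ge0 => i _; exact: psum2_ge0. Qed.

Lemma psum1_le k : psum1 s k <= k%:R.
Proof. by rewrite -(psum2E s) lerDl mulr_ge0// psum2_ge0. Qed.

Lemma psum2_le k : psum2 s k <= k%:R ^+ 2.
Proof.
elim: k => [|k IH]; first by rewrite /psum2 big_ord0.
by rewrite psum2S -natr1; have := psum1_le k; have := ler0n R k; nra.
Qed.

Lemma psum3_le k : psum3 s k <= k%:R ^+ 3.
Proof.
elim: k => [|k IH]; first by rewrite /psum3 big_ord0.
rewrite psum3S -natr1; have := psum2_le k; have k0 := ler0n R k.
have -> : (k%:R + 1) ^+ 3 = k%:R ^+ 3 + (3 * k%:R ^+ 2 + 3 * k%:R + 1) :> R by ring.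
by have := sqr_ge0 (k%:R : R); lra.
Qed.

(** In expectation, this bound and [psum2_gt] turn the bounds on P(X = 0) and P(X <= 1) into lower
    bounds for the difference quotients of the generating function. *)
Lemma psum1_gt k : (0 < k)%N%:R <= psum1 s k.
Proof.
case: k => [|k]; first by rewrite psum1_ge0.
by rewrite /psum1 big_ord_recl expr0 lerDl sumr_ge0// => i _; rewrite exprn_ge0.
Qed.

Lemma psum2_gt k : (1 < k)%N%:R <= psum2 s k.
Proof.
case: k => [|[|k]]; [exact: psum2_ge0|exact: psum2_ge0|].
rewrite /psum2 2!big_ord_recl /psum1 big_ord0 add0r big_ord1 expr0 lerDl.
by apply: sumr_ge0 => i _; exact: psum1_ge0.
Qed.

End bounds.
End power_sums.

Section offspring_law.
Context (d : measure_display) (T : measurableType d) (R : realType).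
Context (P : probability T R) (X : {RV P >-> nat}) (M : R).
Hypothesis X_third : (\int[P]_w ((X w)%:R ^+ 3)%:E <= M%:E)%E.

Let M_ge0 : 0 <= M.
Proof.
rewrite -lee_fin; apply: le_trans X_third; apply: integral_ge0 => w _.
by rewrite lee_fin exprn_ge0.
Qed.

(** The third moment dominates all the functions of X used for (a); the summand 1 covers those that
    do not vanish at k = 0. *)
Lemma offspring_dominated h : (forall k, 0 <= h k <= 1 + k%:R ^+ 3) ->
  nat_summable X h /\ nat_mean X h <= M + 1.
Proof.
move=> hle.
have s3 : nat_summable X (fun k => k%:R ^+ 3).
  by split; [move=> k; rewrite exprn_ge0|exact: le_lt_trans X_third (ltry _)].
have m3 : nat_mean X (fun k => k%:R ^+ 3) <= M by rewrite -lee_fin -nat_meanE.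
have [s1 m1] := @nat_summable_cst _ _ _ _ X 1 ler01.
have [s13 m13] := nat_summableD s1 s3.
have [hs hm] := nat_summable_le hle s13; split=> //.
by apply: le_trans hm _; rewrite m13 m1; lra.
Qed.

Let cube (k : nat) : k%:R <= (k%:R ^+ 3 : R) /\ k%:R ^+ 2 <= (k%:R ^+ 3 : R).
Proof.
by rewrite -[X in X <= _]expr1 -!natrX !ler_nat; case: k => // k; rewrite !leq_pexp2l.
Qed.

Lemma summable_pgf s : 0 <= s <= 1 -> nat_summable X (fun k => s ^+ k).
Proof.
case/andP=> s0 s1; apply: (offspring_dominated _).1 => k.
by rewrite exprn_ge0//= ler_wpDr ?exprn_ge0// exprn_ile1.
Qed.

Lemma summable_id : nat_summable X (fun k => k%:R) /\ nat_mean X (fun k => k%:R) <= M + 1.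
Proof.
by apply: offspring_dominated => k; rewrite ler0n/= ler_wpDl// (cube k).1.
Qed.

Lemma summable_fact2 : nat_summable X (fun k => k%:R * (k%:R - 1)).
Proof.
apply: (offspring_dominated _).1 => k; have := (cube k).2.
case: k => [|k]; first by rewrite mul0r lexx ler_wpDl// exprn_ge0.
move=> h; have k1 : 1 <= k.+1%:R :> R by rewrite ler1n.
apply/andP; split; first by rewrite mulr_ge0// subr_ge0.
rewrite (le_trans _ (le_trans h _)) ?lerDr// expr2; nra.
Qed.

Lemma summable_psum1 s : 0 <= s <= 1 -> nat_summable X (psum1 s).
Proof.
move=> s01; apply: (offspring_dominated _).1 => k; rewrite psum1_ge0//=.
by rewrite (le_trans (psum1_le s01 k))// (le_trans (cube k).1)// lerDr.
Qed.

Lemma summable_psum2 s : 0 <= s <= 1 -> nat_summable X (psum2 s).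
Proof.
move=> s01; apply: (offspring_dominated _).1 => k; rewrite psum2_ge0//=.
by rewrite (le_trans (psum2_le s01 k))// (le_trans (cube k).2)// lerDr.
Qed.

Lemma summable_psum3 s : 0 <= s <= 1 ->
  nat_summable X (psum3 s) /\ nat_mean X (psum3 s) <= M + 1.
Proof.
move=> s01; apply: offspring_dominated => k; rewrite psum3_ge0//=.
by rewrite (le_trans (psum3_le s01 k))// lerDr.
Qed.

Lemma mean_psum1 s : 0 <= s <= 1 ->
  1 - nat_mean X (fun k => s ^+ k) = (1 - s) * nat_mean X (psum1 s).
Proof.
move=> s01; have s1 : 0 <= 1 - s by case/andP: s01; lra.
have [h1 h2] := nat_summableZ s1 (summable_psum1 s01).
have [_] := nat_summableD (summable_pgf s01) h1.
under [in X in X -> _]eq_fun do rewrite psum1E.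
by rewrite (nat_summable_cst _ ler01).2 -h2 => E; lra.
Qed.

Lemma mean_psum2 s : 0 <= s <= 1 ->
  nat_mean X (fun k => k%:R) - nat_mean X (psum1 s) = (1 - s) * nat_mean X (psum2 s).
Proof.
move=> s01; have s1 : 0 <= 1 - s by case/andP: s01; lra.
have [h1 h2] := nat_summableZ s1 (summable_psum2 s01).
have [_] := nat_summableD (summable_psum1 s01) h1.
under [in X in X -> _]eq_fun do rewrite psum2E.
by rewrite -h2 => E; lra.
Qed.

Lemma mean_psum3 s : 0 <= s <= 1 ->
  nat_mean X (fun k => k%:R * (k%:R - 1)) / 2 - nat_mean X (psum2 s) =
    (1 - s) * nat_mean X (psum3 s).
Proof.
move=> s01; have s1 : 0 <= 1 - s by case/andP: s01; lra.
have [h1 h2] := nat_summableZ s1 (summable_psum3 s01).1.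
have [_] := nat_summableD (summable_psum2 s01) h1.
under [in X in X -> _]eq_fun do rewrite psum3E mulrC.
have half : 0 <= 2^-1 :> R by rewrite invr_ge0.
by rewrite (nat_summableZ half summable_fact2).2 -h2 => E; lra.
Qed.

Lemma mean_gt0 (delta : R) : (P [set w | X w = 0%N] <= (1 - delta)%:E)%E ->
  delta <= nat_mean X (fun k => (0 < k)%N%:R).
Proof.
move=> h.
have [h0 e0] := nat_summable_indic X (fun k => k == 0%N).
have [h1 e1] := nat_summable_indic X (fun k => (0 < k)%N).
have [_ e] := nat_summableD h0 h1.
have E : nat_mean X (fun k => (k == 0%N)%:R + (0 < k)%N%:R) = 1.
  rewrite -[RHS](nat_summable_cst X ler01).2; congr nat_mean; apply/funext => -[|k] /=.
    by rewrite addr0.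
  by rewrite add0r.
have : nat_mean X (fun k => (k == 0%N)%:R) <= 1 - delta.
  rewrite -lee_fin -e0; apply: le_trans h; rewrite le_eqVlt; apply/orP; left.
  by apply/eqP; congr (P _); apply/seteqP; split => w /= /eqP.
by move: E; rewrite e; lra.
Qed.

Lemma mean_gt1 (eps : R) :
  (P [set w | X w = 0%N] + P [set w | X w = 1%N] <= (1 - eps)%:E)%E ->
  eps <= nat_mean X (fun k => (1 < k)%N%:R).
Proof.
move=> h.
have [h0 e0] := nat_summable_indic X (fun k => k == 0%N).
have [h1 e1] := nat_summable_indic X (fun k => k == 1%N).
have [h2 e2] := nat_summable_indic X (fun k => (1 < k)%N).
have [h01 e01] := nat_summableD h0 h1.
have [_ e] := nat_summableD h01 h2.
have E : nat_mean X (fun k => (k == 0%N)%:R + (k == 1%N)%:R + (1 < k)%N%:R) = 1.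
  rewrite -[RHS](nat_summable_cst X ler01).2; congr nat_mean; apply/funext => -[|[|k]] /=.
  - by rewrite !addr0.
  - by rewrite add0r addr0.
  - by rewrite !add0r.
have : nat_mean X (fun k => (k == 0%N)%:R) + nat_mean X (fun k => (k == 1%N)%:R) <= 1 - eps.
  rewrite -lee_fin EFinD -e0 -e1; apply: le_trans h; rewrite le_eqVlt; apply/orP; left.
  by apply/eqP; congr (P _ + P _)%E; apply/seteqP; split => w /= /eqP.
by move: E; rewrite e e01; lra.
Qed.

End offspring_law.

(** * The process conditioned on survival *)

Lemma coef0_exp (R : comNzRingType) (q : {poly R}) n : (q ^+ n)`_0 = q`_0 ^+ n.
Proof.
elim: n => [|n IH]; first by rewrite !expr0 coef1.
by rewrite !exprS coef0M IH.
Qed.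

Lemma coef1_exp (R : comNzRingType) (q : {poly R}) n :
  (q ^+ n.+1)`_1 = n.+1%:R * q`_0 ^+ n * q`_1.
Proof.
elim: n => [|n IH]; first by rewrite expr1 expr0 mulr1 mul1r.
rewrite exprS coefM !big_ord_recl big_ord0 addr0 /= subn0 IH coef0_exp.
rewrite /bump /= -(@natr1 R n.+1) !exprS; ring.
Qed.

(** The coefficients are l! times the Stirling numbers of the second kind; their recurrence comes
    from multiplying a binomial coefficient by k. Only the top one is needed explicitly. *)
Lemma exp_binomial_basis (r : nat) : exists c : nat -> nat, c r.+1 = r.+1`! /\
  forall k, (k ^ r.+1 = \sum_(1 <= l < r.+2) c l * 'C(k, l))%N.
Proof.
elim: r => [|r [c [cr cE]]].
  by exists (fun=> 1%N); split => // k; rewrite big_nat1 bin1 mul1n expn1.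
(* The guards discard the values of [c] outside 1 .. r + 1, which are arbitrary. *)
exists (fun l => (if (l <= r.+1)%N then l * c l else 0) + (if (1 < l)%N then l * c l.-1 else 0))%N.
split; first by rewrite ltnn add0n /= cr.
move=> k; rewrite expnSr cE big_distrl/=.
have binE l : ('C(k, l) * k = l * 'C(k, l) + l.+1 * 'C(k, l.+1))%N.
  rewrite mul_bin_left; have [lk|kl] := leqP l k; last by rewrite bin_small// !muln0 mul0n.
  by rewrite mulnC -mulnDl subnKC.
under eq_bigr => l _ do rewrite -mulnA binE mulnDr.
rewrite big_split/=; under [in RHS]eq_bigr => l _ do rewrite mulnDl.
rewrite [in RHS]big_split/=; congr addn.
  rewrite [RHS]big_nat_recr//= ltnn mul0n addn0 big_nat [RHS]big_nat.
  by apply: eq_bigr => l /andP[_ lr]; rewrite -ltnS lr; ring.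
rewrite [RHS]big_nat_recl//= mul0n add0n big_nat [RHS]big_nat.
by apply: eq_bigr => l /andP[l1 _]; rewrite ltnS l1; ring.
Qed.

(** With y = k / c_n, the inequalities y / (1 + y) <= 1 - exp(- y) <= y place the quotient between 1
    / k and 1 / k + 1 / c_n. *)
Lemma laplace_scale (R : realType) (c : nat -> R) (k : R) : 0 < k ->
  (forall n, 0 < c n) -> (c n)^-1 @[n --> \oo] --> (0 : R) ->
  (c n)^-1 / (1 - expR (- (k / c n))) @[n --> \oo] --> k^-1.
Proof.
move=> k0 c0 coo.
have h : k^-1 + (c n)^-1 @[n --> \oo] --> (k^-1 + 0 : R).
  by apply: cvgD => //; exact: cvg_cst.
rewrite addr0 in h; apply: (squeeze_cvgr _ (cvg_cst k^-1) h); apply: nearW => n /=.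
have y0 : 0 < k / c n by rewrite divr_gt0.
have e_lt : expR (- (k / c n)) < 1 by rewrite expRN invf_lt1 ?expR_gt0// expR_gt1.
have x0 : 0 < 1 - expR (- (k / c n)) by rewrite subr_gt0.
have h1 : 1 - expR (- (k / c n)) <= k / c n.
  by have := expR_ge1Dx (- (k / c n)); lra.
have h2 : (k / c n) <= (1 + k / c n) * (1 - expR (- (k / c n))).
  have := expR_ge1Dx (k / c n); rewrite expRN => h3.
  have : (1 + k / c n) * (expR (k / c n))^-1 <= 1.
    by rewrite ler_pdivrMr ?expR_gt0// mul1r.
  lra.
move: e_lt x0 h1 h2; set E := expR _ => e_lt x0 h1 h2.
have k1 : k / c n * k^-1 = (c n)^-1 by rewrite mulrAC divff ?mul1r// gt_eqF.
apply/andP; split.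
  by rewrite ler_pdivlMr// -k1 mulrC ler_pM2r// invr_gt0.
rewrite ler_pdivrMr// -{1}k1.
have -> : (k^-1 + (c n)^-1) * (1 - E) = (1 + k / c n) * (1 - E) * k^-1.
  by rewrite -{1}k1; ring.
by rewrite ler_pM2r// invr_gt0.
Qed.

Section process.
Context (R : realType) (d0 : measure_display) (T0 : measurableType d0).
Context (P0 : probability T0 R) (X : nat -> {RV P0 >-> nat}).
Context (d : measure_display) (T : measurableType d) (P : probability T R).
Context (xi : nat -> nat -> {RV P >-> nat}).
Hypothesis xi_indep : mutually_independent (fun nj : nat * nat => xi nj.1 nj.2).
Hypothesis xi_law : forall n j : nat, same_distribution (xi n j) (X n).
Let Z := branching (fun n j => (xi n j : T -> nat)).

Lemma integral_offspring n j (h : nat -> R) : (forall k, 0 <= h k) ->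
  (\int[P]_w (h (xi n j w))%:E = \int[P0]_w (h (X n w))%:E)%E.
Proof.
move=> h0; rewrite !integral_nat//; apply: eq_eseriesr => k _.
by rewrite !setTI; congr (_ * _)%E; exact: (@xi_law n j [set k]).
Qed.

Lemma integral_generation0 (h : nat -> R) :
  (\int[P]_w (h (Z 0 w))%:E = (h 1%N)%:E)%E.
Proof.
transitivity (\int[P]_w cst (h 1%N)%:E w)%E => //.
by rewrite integral_cst//= [P _]probability_setT mule1.
Qed.

Section binomial_moments.
Variable N : nat.
Hypothesis X_bin : forall n k, (k <= N)%N -> nat_summable (X n) (fun i => 'C(i, k)%:R).

Let e n k := nat_mean (X n) (fun i => 'C(i, k)%:R).

Definition bin_moment (r n : nat) : R := fine (\int[P]_w ('C(Z n w, r)%:R)%:E)%E.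

(* For l <= r <= N, the coefficient of u^r in (g_n(1 + u) - 1)^l. *)
Definition bin_coef n l r := ((\poly_(k < N) e n k.+1) ^+ l)`_(r - l).

Lemma integral_bin_step n r : (r <= N)%N ->
  (\int[P]_w ('C(Z n.+1 w, r)%:R)%:E =
    \sum_(l < r.+1) (bin_coef n l r)%:E * \int[P]_w ('C(Z n w, l)%:R)%:E)%E.
Proof.
(* No summability is known beyond order N. Setting the moments to 0 there leaves the truncated
   polynomial unchanged. *)
move=> rN; pose e' k := if (k <= N)%N then e n k else 0.
have -> : (\int[P]_w ('C(Z n.+1 w, r)%:R)%:E = \sum_(l < r.+1)
    (((\poly_(k < N) e' k.+1) ^+ l)`_(r - l))%:E * \int[P]_w ('C(Z n w, l)%:R)%:E)%E.
  apply: (integral_branching_bin xi_indep (e := e')) => //.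
  - by move=> k; rewrite /e'; case: ifP => // kN; exact/nat_mean_ge0/X_bin.
  - rewrite /e' leq0n /e; under eq_fun do rewrite bin0.
    by rewrite (nat_summable_cst _ ler01).2.
  - move=> j k kN; rewrite (integral_offspring _ _ (h := fun i => 'C(i, k)%:R))//.
    by rewrite (nat_meanE (X_bin n kN)) /e' kN.
suff -> : \poly_(k < N) e' k.+1 = \poly_(k < N) e n k.+1 by [].
by apply/polyP => k; rewrite !coef_poly /e'; case: ltnP.
Qed.

Lemma integral_bin r n : (r <= N)%N ->
  (\int[P]_w ('C(Z n w, r)%:R)%:E = (bin_moment r n)%:E)%E.
Proof.
move=> rN; rewrite /bin_moment fineK//.
elim: n r rN => [|n IH] r rN.
  by rewrite (integral_generation0 (fun k => 'C(k, r)%:R)).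
rewrite integral_bin_step//; apply/sum_fin_numP => l _ _.
by rewrite fin_numM// IH// (leq_trans _ rN)// -ltnS.
Qed.

Lemma bin_momentS r n : (r <= N)%N ->
  bin_moment r n.+1 = \sum_(l < r.+1) bin_coef n l r * bin_moment l n.
Proof.
move=> rN; apply: EFin_inj; rewrite -integral_bin// integral_bin_step// -sumEFin.
apply: eq_bigr => l _; rewrite EFinM integral_bin// (leq_trans _ rN)//.
by rewrite -ltnS.
Qed.

Lemma bin_moment0 r : bin_moment r 0 = 'C(1, r)%:R.
Proof. by rewrite /bin_moment (integral_generation0 (fun k => 'C(k, r)%:R)). Qed.

Lemma bin_moment_ge0 r n : 0 <= bin_moment r n.
Proof. by apply: fine_ge0; apply: integral_ge0 => w _; rewrite lee_fin. Qed.

End binomial_moments.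

(** * Survival probability and Laplace transforms *)

Section survival.
Variables (M delta eps : R) (N0 : nat).
Hypothesis X_third : forall n, (\int[P0]_w ((X n w)%:R ^+ 3)%:E <= M%:E)%E.
Hypothesis delta_gt0 : 0 < delta.
Hypothesis X_eq0 : forall n, (P0 [set w | X n w = 0%N] <= (1 - delta)%:E)%E.
Hypothesis eps_gt0 : 0 < eps.
Hypothesis X_le1 : forall n, (N0 <= n)%N ->
  (P0 [set w | X n w = 0%N] + P0 [set w | X n w = 1%N] <= (1 - eps)%:E)%E.

Let m n := mean_nat P (Z n).
Let Gam n := Gamma P0 X m n.
Hypothesis Gam_infty : Gam n @[n --> \oo] --> +oo.
Hypothesis mGam_infty : (m n * Gam n) @[n --> \oo] --> +oo.

Let mu n := nat_mean (X n) (fun k => k%:R).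
Let b n := nat_mean (X n) (fun k => k%:R * (k%:R - 1)).
Let g n s := nat_mean (X n) (fun k => s ^+ k).
Let q n s := nat_mean (X n) (psum1 s).
Let beta n s := nat_mean (X n) (psum2 s).

Let I01 (s : R) : 0 <= s < 1 -> 0 <= s <= 1.
Proof. by case/andP => -> /ltW. Qed.

Let X_bin1 n k : (k <= 1)%N -> nat_summable (X n) (fun i => 'C(i, k)%:R).
Proof.
case: k => [|[|//]] _.
  by under eq_fun do rewrite bin0; exact: (nat_summable_cst _ ler01).1.
under eq_fun do rewrite bin1; exact: (summable_id (X_third n)).1.
Qed.

Lemma mean_generation n : m n = bin_moment 1 n.
Proof.
rewrite /m /mean_nat unlock /bin_moment; congr fine.
by apply: eq_integral => w _; rewrite bin1.
Qed.

Lemma integral_generation n : (\int[P]_w ((Z n w)%:R)%:E = (m n)%:E)%E.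
Proof.
rewrite mean_generation -(integral_bin X_bin1)//.
by apply: eq_integral => w _; rewrite bin1.
Qed.

Lemma mean_generation0 : m 0%N = 1.
Proof. by rewrite mean_generation bin_moment0 bin1. Qed.

Lemma mean_generationS n : m n.+1 = m n * mu n.
Proof.
rewrite !mean_generation (bin_momentS X_bin1)// !big_ord_recl big_ord0 addr0 /bin_coef /=.
rewrite expr0 coef1 mul0r add0r expr1 coef_poly /= mulrC; congr (_ * _).
by congr nat_mean; apply/funext => k; rewrite bin1.
Qed.

Lemma GammaE n : Gam n = \sum_(j < n) b j / (2 * mu j * m j.+1).
Proof.
by rewrite /Gam /Gamma; apply: eq_bigr => j _; rewrite /fact_moment2 /mean_nat unlock.
Qed.

Let mu_le n : mu n <= M + 1.
Proof. exact: (summable_id (X_third n)).2. Qed.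

Let qE n s : 0 <= s < 1 -> 1 - g n s = (1 - s) * q n s.
Proof. by move=> /I01; exact: mean_psum1. Qed.

Let q_bounds n s : 0 <= s < 1 -> delta <= q n s <= mu n.
Proof.
move=> /I01 s01; apply/andP; split.
  apply: le_trans (mean_gt0 (X_eq0 n)) _.
  apply: (nat_summable_le _ (summable_psum1 (X_third n) s01)).2 => k.
  by rewrite ler0n psum1_gt.
apply: (nat_summable_le _ (summable_id (X_third n)).1).2 => k.
by rewrite psum1_ge0// psum1_le.
Qed.

Let betaE n s : 0 <= s < 1 -> mu n - q n s = (1 - s) * beta n s.
Proof. by move=> /I01; exact: mean_psum2. Qed.

Let beta_ge0 n s : 0 <= s < 1 -> 0 <= beta n s.
Proof. by move=> /I01 s01; exact/nat_mean_ge0/(summable_psum2 (X_third n)). Qed.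

Let beta_b n s : 0 <= s < 1 -> 0 <= b n / 2 - beta n s <= (M + 1) * (1 - s).
Proof.
move=> /I01 s01; have [h1 h2] := summable_psum3 (X_third n) s01.
have s1 : 0 <= 1 - s by case/andP: s01; lra.
rewrite (mean_psum3 (X_third n))//.
by rewrite mulr_ge0 ?nat_mean_ge0//= mulrC ler_wpM2r.
Qed.

Let beta_eps n s : (N0 <= n)%N -> 0 <= s < 1 -> eps <= beta n s.
Proof.
move=> Nn /I01 s01; apply: le_trans (mean_gt1 (X_le1 Nn)) _.
apply: (nat_summable_le _ (summable_psum2 (X_third n) s01)).2 => k.
by rewrite ler0n psum2_gt.
Qed.

Let g_ge0 n s : 0 <= s < 1 -> 0 <= g n s.
Proof. by move=> /I01 s01; exact/nat_mean_ge0/(summable_pgf (X_third n)). Qed.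

Let Gam_funE : Gam = (fun n => \sum_(j < n) b j / (2 * mu j * m j.+1)).
Proof. by apply/funext => n; exact: GammaE. Qed.

Lemma mean_generation_gt0 n : 0 < m n.
Proof. exact: (means_gt0 delta_gt0 q_bounds mean_generation0 mean_generationS). Qed.

Definition pgf n s : R := fine (\int[P]_w (s ^+ Z n w)%:E).

(** The recursion runs down from index n, so the induction keeps s general: g_n(s) is the endpoint
    of the shorter orbit. *)
Lemma orbit_exists n s : 0 <= s < 1 ->
  exists u : nat -> R, [/\ u n = s, forall j, (j < n)%N -> u j = g j (u j.+1) &
    forall j, (j <= n)%N -> 0 <= u j < 1].
Proof.
move=> s01; elim: n s s01 => [|n IH] s s01.
  by exists (fun=> s).
have gs01 : 0 <= g n s < 1.
  rewrite g_ge0//= -subr_gt0 qE// mulr_gt0//; first by case/andP: s01; lra.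
  by have /andP[h _] := q_bounds n s01; exact: lt_le_trans h.
have [u [un ug u01]] := IH (g n s) gs01.
exists (fun j => if j == n.+1 then s else u j); split.
- by rewrite eqxx.
- move=> j; rewrite ltnS leq_eqVlt => /orP[/eqP ->|jn].
    by rewrite eqxx ltn_eqF.
  have -> : (j == n.+1) = false by rewrite ltn_eqF// leqW.
  by rewrite eqSS ltn_eqF// ug.
move=> j; rewrite leq_eqVlt ltnS; case: eqP => //= _.
exact: u01.
Qed.

(** Along an orbit, E(u_j^(Z_j)) does not depend on j. *)
Lemma pgf_orbit n (u : nat -> R) : (forall j, (j <= n)%N -> 0 <= u j < 1) ->
  (forall j, (j < n)%N -> u j = g j (u j.+1)) ->
  (\int[P]_w (u n ^+ Z n w)%:E = (u 0%N)%:E)%E.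
Proof.
move=> u01 ug.
suff H j : (j <= n)%N -> (\int[P]_w (u j ^+ Z j w)%:E = (u 0%N)%:E)%E by exact: H.
elim: j => [|j IH] jn; first by rewrite (integral_generation0 (fun k => u 0%N ^+ k)).
have /andP[uj0 _] := u01 j.+1 jn.
rewrite (integral_branching_pgf xi_indep (c := u j)) ?IH ?(ltnW jn)// => i.
rewrite (integral_offspring _ _ (h := fun k => u j.+1 ^+ k)); last by move=> k; rewrite exprn_ge0.
by rewrite (nat_meanE (summable_pgf (X_third j) (I01 (u01 _ jn)))) (ug j jn).
Qed.

Lemma integral_pgf n s : 0 <= s < 1 ->
  (\int[P]_w (s ^+ Z n w)%:E = (pgf n s)%:E)%E /\ 0 <= pgf n s < 1.
Proof.
move=> s01; have [u [un ug u01]] := orbit_exists n s01.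
by rewrite /pgf -un (pgf_orbit u01 ug); split=> //; exact: u01.
Qed.

Lemma reciprocal_pgf e : 0 < e -> \forall n \near \oo, forall s, 0 <= s < 1 ->
  `|(1 - pgf n s)^-1 - (m n * (1 - s))^-1 - Gam n| <= e * Gam n.
Proof.
move=> e0; have := Gam_infty; have := mGam_infty; rewrite Gam_funE => h1 h2.
have := reciprocal_orbit delta_gt0 eps_gt0 mu_le qE q_bounds betaE beta_ge0 beta_b
  beta_eps mean_generation0 mean_generationS g_ge0 h2 h1 e0.
apply: filterS => n H s s01; have [u [un ug u01]] := orbit_exists n s01.
have := H u _ ug; rewrite un => /(_ s01).
by rewrite /pgf -un (pgf_orbit u01 ug).
Qed.

(** As 0 ^+ 0 = 1, [pgf n 0] is P(Z_n = 0). *)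
Definition survival_prob n := 1 - pgf n 0.

Let I0 : 0 <= (0 : R) < 1. Proof. by rewrite lexx ltr01. Qed.

Lemma survival_gt0 n : 0 < survival_prob n.
Proof. by have [_ /andP[_]] := integral_pgf n I0; rewrite /survival_prob subr_gt0. Qed.

Lemma survival_probE n : (P [set w | Z n w <> 0%N] = (survival_prob n)%:E)%E.
Proof.
have m0 : measurable (Z n @^-1` [set 0%N]) by exact: (indep_branching xi_indep n 0%N).1.
have -> : [set w | Z n w <> 0%N] = ~` (Z n @^-1` [set 0%N]) by [].
rewrite probability_setC// /survival_prob EFinB -(integral_pgf n I0).1.
rewrite -[in LHS](setIT (_ @^-1` _)) -integral_indic//; congr (_ - _)%E.
apply: eq_integral => w _; rewrite indicE expr0n.
by case: eqP => h; [rewrite mem_set|rewrite memNset].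
Qed.

Lemma Gam_gt0 : \forall n \near \oo, 0 < Gam n.
Proof. by move/cvgryPgt : Gam_infty; apply. Qed.

Lemma inv_mean_small : (m n)^-1 / Gam n @[n --> \oo] --> (0 : R).
Proof.
apply/cvgrPdist_le => e e0; near=> n.
have G0 : 0 < Gam n by near: n; exact: Gam_gt0.
have mi0 : 0 < (m n)^-1 by rewrite invr_gt0 mean_generation_gt0.
rewrite sub0r normrN gtr0_norm ?divr_gt0// ler_pdivrMr//.
near: n; move: mGam_infty; rewrite Gam_funE => h.
exact: (inv_means_small delta_gt0 q_bounds mean_generation0 mean_generationS h e0).
Unshelve. all: by end_near. Qed.

Lemma survival_Gamma : survival_prob n * Gam n @[n --> \oo] --> (1 : R).
Proof.
suff : (survival_prob n * Gam n)^-1 @[n --> \oo] --> (1 : R).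
  move=> h; have h' : (survival_prob n * Gam n)^-1^-1 @[n --> \oo] --> (1^-1 : R).
    by apply: cvgV => //; exact: oner_neq0.
  by rewrite invr1 in h'; apply: near_cvg h'; apply: nearW => n; rewrite invrK.
apply/cvgrPdist_le => e e0; have e2 : 0 < e / 2 by rewrite divr_gt0.
near=> n.
have G0 : 0 < Gam n by near: n; exact: Gam_gt0.
have p0 := survival_gt0 n.
have h1 : `|(survival_prob n)^-1 - (m n)^-1 - Gam n| <= e / 2 * Gam n.
  suff : forall s, 0 <= s < 1 ->
    `|(1 - pgf n s)^-1 - (m n * (1 - s))^-1 - Gam n| <= e / 2 * Gam n.
    by move=> /(_ 0 I0); rewrite subr0 mulr1.
  by near: n; exact: (reciprocal_pgf e2).
have h2 : `|0 - (m n)^-1 / Gam n| <= e / 2.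
  by near: n; move/cvgrPdist_le : inv_mean_small; apply.
have mi0 : 0 < (m n)^-1 by rewrite invr_gt0 mean_generation_gt0.
rewrite sub0r normrN gtr0_norm ?divr_gt0// ler_pdivrMr// in h2.
rewrite distrC invfM.
have -> : (survival_prob n)^-1 * (Gam n)^-1 - 1 = ((survival_prob n)^-1 - Gam n) / Gam n.
  by rewrite mulrBl divff// gt_eqF.
rewrite normf_div (gtr0_norm G0) ler_pdivrMr//.
have -> : (survival_prob n)^-1 - Gam n =
    ((survival_prob n)^-1 - (m n)^-1 - Gam n) + (m n)^-1 by ring.
apply: le_trans (ler_normD _ _) _; rewrite (gtr0_norm mi0); lra.
Unshelve. all: by end_near. Qed.

(* The mean of [Z n] given survival, that is of [zeta n]. *)
Definition cond_mean n := m n / survival_prob n.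

Lemma cond_mean_gt0 n : 0 < cond_mean n.
Proof. by rewrite divr_gt0 ?survival_gt0 ?mean_generation_gt0. Qed.

(** 1 / E(zeta_n) is the product of P(Z_n <> 0) Gamma_n, which tends to 1, and 1 / (m_n Gamma_n),
    which tends to 0 by (v). *)
Lemma inv_cond_mean_cvg0 : (cond_mean n)^-1 @[n --> \oo] --> (0 : R).
Proof.
have h : (survival_prob n * Gam n) * ((m n)^-1 / Gam n) @[n --> \oo] --> (1 * 0 : R).
  by apply: cvgM; [exact: survival_Gamma|exact: inv_mean_small].
rewrite mulr0 in h; apply: near_cvg h; near=> n.
have G0 : 0 < Gam n by near: n; exact: Gam_gt0.
rewrite /cond_mean invf_div; field; rewrite gt_eqF//= gt_eqF// mean_generation_gt0//.
Unshelve. all: by end_near. Qed.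

(** For k > 0, multiplying the reciprocal estimate by P(Z_n <> 0) shows that P(Z_n <> 0) / (1 -
    f_n(s_n)) tends to 1 / k + 1, and 1 - 1 / (1 / k + 1) = 1 / (k + 1). *)
Lemma laplace_limit (k : nat) :
  1 - (1 - pgf n (expR (- (k%:R / cond_mean n)))) / survival_prob n @[n --> \oo] -->
    (k.+1%:R^-1 : R).
Proof.
(* For k = 0 the argument is s = 1, outside the range of the reciprocal estimate. *)
case: k => [|k].
  have pgf1 n : pgf n 1 = 1.
    rewrite /pgf; under eq_integral do rewrite expr1n.
    by rewrite integral_cst//= [P _]probability_setT mule1.
  rewrite invr1; under eq_fun do rewrite mul0r oppr0 expR0 pgf1 subrr mul0r subr0.
  exact: cvg_cst.
pose s n := expR (- (k.+1%:R / cond_mean n)).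
have y0 n : 0 < k.+1%:R / cond_mean n by rewrite divr_gt0 ?cond_mean_gt0.
have s01 n : 0 <= s n < 1.
  by rewrite /s expR_ge0/= expRN invf_lt1 ?expR_gt0// expR_gt1.
have k0 : 0 < k.+1%:R :> R by [].
have L := laplace_scale k0 cond_mean_gt0 inv_cond_mean_cvg0.
pose t n := survival_prob n / (1 - pgf n (s n)).
have r0 : t n - (cond_mean n)^-1 / (1 - s n) - survival_prob n * Gam n @[n --> \oo] --> (0 : R).
  apply/cvgrPdist_le => e e0; have e2 : 0 < e / 2 by rewrite divr_gt0.
  near=> n.
  have G0 : 0 < Gam n by near: n; exact: Gam_gt0.
  have p0 := survival_gt0 n.
    have h1 : `|(1 - pgf n (s n))^-1 - (m n * (1 - s n))^-1 - Gam n| <= e / 2 * Gam n.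
    suff : forall s, 0 <= s < 1 ->
      `|(1 - pgf n s)^-1 - (m n * (1 - s))^-1 - Gam n| <= e / 2 * Gam n by exact.
    by near: n; exact: (reciprocal_pgf e2).
  have pG : `|1 - survival_prob n * Gam n| <= 1.
    by near: n; move/cvgrPdist_le : survival_Gamma; apply.
  rewrite sub0r normrN.
  have -> : t n - (cond_mean n)^-1 / (1 - s n) - survival_prob n * Gam n =
      survival_prob n * ((1 - pgf n (s n))^-1 - (m n * (1 - s n))^-1 - Gam n).
    by rewrite /t /cond_mean invf_div invfM; ring.
  rewrite normrM (gtr0_norm p0); apply: le_trans (ler_wpM2l (ltW p0) h1) _.
  by move: pG; rewrite ler_norml; nra.
have t_lim : t n @[n --> \oo] --> (0 + k.+1%:R^-1 + 1 : R).
  have h : (t n - (cond_mean n)^-1 / (1 - s n) - survival_prob n * Gam n) +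
      (cond_mean n)^-1 / (1 - s n) + survival_prob n * Gam n @[n --> \oo] --> (0 + k.+1%:R^-1 + 1 : R).
    by apply: cvgD; [apply: cvgD|exact: survival_Gamma].
  by apply: near_cvg h; apply: nearW => n; ring.
have t_neq0 : 0 + k.+1%:R^-1 + 1 != 0 :> R by rewrite add0r gt_eqF// addr_gt0// invr_gt0.
have h : 1 - (t n)^-1 @[n --> \oo] --> (1 - (0 + k.+1%:R^-1 + 1)^-1 : R).
  by apply: cvgB; [exact: cvg_cst|exact: cvgV].
have -> : k.+2%:R^-1 = 1 - (0 + k.+1%:R^-1 + 1)^-1 :> R.
  rewrite add0r -(@natr1 R k.+1); field.
  by rewrite !gt_eqF// ?addr_gt0.
by apply: near_cvg h; apply: nearW => n; rewrite [in RHS]/t [in RHS]invf_div.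
Unshelve. all: by end_near. Qed.

(** * The law conditioned on survival *)

Section conditioned.
Context (dz : nat -> measure_display) (Tz : forall n, measurableType (dz n)).
Context (Pz : forall n, probability (Tz n) R) (zeta : forall n, {RV (Pz n) >-> nat}).
Hypothesis zeta_law : forall (n : nat) (A : set nat),
  distribution (Pz n) (zeta n) A = cond_prob P (Z n @^-1` A) [set w | Z n w <> 0%N].

(** Because h vanishes at 0, restricting to survival does not change the integral of h(Z_n), and
    conditioning only divides it by P(Z_n <> 0). *)
Lemma integral_zeta n (h : nat -> R) : (forall k, 0 <= h k) -> h 0%N = 0 ->
  (\int[Pz n]_w (h (zeta n w))%:E =
    ((survival_prob n)^-1)%:E * \int[P]_w (h (Z n w))%:E)%E.
Proof.
move=> h0 hz; rewrite !integral_nat//; last exact: measurable_branching.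
rewrite -nneseriesZl; last by move=> k _; rewrite mule_ge0// lee_fin.
apply: eq_eseriesr => k _; rewrite !setTI.
have := zeta_law n [set k]; rewrite /cond_prob survival_probE inver gt_eqF ?survival_gt0//.
rewrite /distribution /pushforward/= => ->.
have [->|k0] := eqVneq k 0%N; first by rewrite hz !mul0e mule0.
rewrite [in RHS]muleCA; congr (_ * _)%E; rewrite muleC; congr (_ * P _)%E.
by apply/seteqP; split => [w []//|w /= ->]; split => //; exact/eqP.
Qed.

Lemma mean_zeta n : mean_nat (Pz n) (zeta n) = cond_mean n.
Proof.
rewrite /mean_nat unlock (integral_zeta n (h := fun k => k%:R))//.
by rewrite integral_generation /cond_mean -EFinM /= mulrC.
Qed.

(** s^k does not vanish at k = 0, so [integral_zeta] is applied to 1 - s^k. *)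
Lemma laplace_zeta n s : 0 <= s < 1 ->
  nat_mean (zeta n) (fun k => s ^+ k) = 1 - (1 - pgf n s) / survival_prob n.
Proof.
move=> s01; have /andP[s0 /ltW s1] := s01.
have s1k k : 0 <= 1 - s ^+ k by rewrite subr_ge0 exprn_ile1.
have hs : nat_summable (zeta n) (fun k => s ^+ k).
  apply: (nat_summable_le _ (nat_summable_cst _ ler01).1).1 => k.
  by rewrite exprn_ge0 ?exprn_ile1.
have hs' : nat_summable (zeta n) (fun k => 1 - s ^+ k).
  apply: (nat_summable_le _ (nat_summable_cst _ ler01).1).1 => k.
  by rewrite s1k lerBlDr lerDl exprn_ge0.
have [_] := nat_summableD hs hs'.
under [in X in X -> _]eq_fun do rewrite addrC subrK.
rewrite (nat_summable_cst _ ler01).2 => E.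
suff -> : (1 - pgf n s) / survival_prob n = nat_mean (zeta n) (fun k => 1 - s ^+ k) by lra.
apply: EFin_inj; rewrite -nat_meanE// (integral_zeta n (h := fun k => 1 - s ^+ k))//; last first.
  by rewrite expr0 subrr.
rewrite mulrC EFinM; congr (_ * _)%E; rewrite EFinB -(integral_pgf n s01).1.
have mZ := measurable_branching xi_indep n.
have -> : (1%:E = \int[P]_w (1 - s ^+ Z n w)%:E + \int[P]_w (s ^+ Z n w)%:E)%E.
  rewrite -ge0_integralD//.
  - under eq_integral do rewrite -EFinD subrK.
    by rewrite integral_cst//= [P _]probability_setT mule1.
  - by move=> w _; rewrite lee_fin.
  - exact: (measurable_EFin_nat (fun k => 1 - s ^+ k)).
  - by move=> w _; rewrite lee_fin exprn_ge0.
  - exact: (measurable_EFin_nat (fun k => s ^+ k)).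
by rewrite addeK// (integral_pgf n s01).1.
Qed.

Lemma integrable_bounded_nat n (h : nat -> R) : bounded_real h ->
  (Pz n).-integrable setT (EFin \o (fun w => h (zeta n w))).
Proof.
move=> [A hA]; apply: measurable_bounded_integrable => //.
- by rewrite [X in (X < _)%E]probability_setT ltry.
- by apply/measurable_EFinP; exact: measurable_EFin_nat.
- exists A; split; first exact: num_real.
  by move=> x Ax w _ /=; rewrite (le_trans (hA _))// ltW.
Qed.

(** The event zeta_n / E(zeta_n) <= x is exp(- x) <= U_n with U_n = exp(- zeta_n / E(zeta_n)), whose
    moments tend to those of the uniform law. *)
Lemma exponential_limit (x : R) : 0 <= x ->
  Pz n [set w | (zeta n w)%:R / cond_mean n <= x] @[n --> \oo] --> (1 - expR (- x))%:E.
Proof.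
move=> x0; pose U n (v : nat) := expR (- (v%:R / cond_mean n)).
have U01 n v : 0 <= U n v <= 1.
  rewrite expR_ge0/= -expR0 ler_expR oppr_le0 divr_ge0//.
  exact/ltW/cond_mean_gt0.
have U_moment k : nat_mean (zeta n) (fun v => U n v ^+ k) @[n --> \oo] --> (k.+1%:R^-1 : R).
  case: k => [|k].
    rewrite invr1; under eq_fun => n do
      (under [X in nat_mean _ X]eq_fun do rewrite expr0; rewrite (nat_summable_cst _ ler01).2).
    exact: cvg_cst.
  apply: near_cvg (laplace_limit (k := k.+1)); apply: nearW => n.
  rewrite -laplace_zeta; last first.
    by rewrite expR_ge0/= expRN invf_lt1 ?expR_gt0// expR_gt1 divr_gt0// cond_mean_gt0.
  by congr nat_mean; apply/funext => v; rewrite /U -!expRM_natl; congr expR; ring.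
have a01 : 0 <= expR (- x) <= 1 by rewrite expR_ge0/= -expR0 ler_expR oppr_le0.
have lim : nat_mean (zeta n) (fun v => (expR (- x) <= U n v)%R%:R) @[n --> \oo] -->
    (1 - expR (- x) : R).
  apply: (karamata (L := fun n => nat_mean (zeta n))) => //.
  - move=> n h h' /(integrable_bounded_nat n) hi /(integrable_bounded_nat n) hi'.
    exact: RintegralD.
  - by move=> n c h /(integrable_bounded_nat n) hi; exact: RintegralZl.
  - move=> n h h' /(integrable_bounded_nat n) hi /(integrable_bounded_nat n) hi' hh'.
    by apply: le_Rintegral => // w _; exact: hh'.
  - by move=> n; exact: (nat_summable_cst (zeta n) ler01).2.
have -> : (fun n => Pz n [set w | (zeta n w)%:R / cond_mean n <= x]) =
    (fun n => (nat_mean (zeta n) (fun v => (expR (- x) <= U n v)%R%:R))%:E).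
  apply/funext => n; rewrite -(nat_summable_indic (zeta n) (fun v => expR (- x) <= U n v)).2.
  congr (Pz n _); apply/seteqP; split => w /=.
    by rewrite /U ler_expR lerN2.
  by rewrite /U ler_expR lerN2.
apply: cvg_EFin => //; exact: nearW.
Qed.

(** * Convergence of all moments *)

Section all_moments.
Variable K : nat -> R.
Hypothesis X_bin : forall n k, nat_summable (X n) (fun i => 'C(i, k)%:R).
Hypothesis X_binK : forall n k, nat_mean (X n) (fun i => 'C(i, k)%:R) <= K k.

Let gamma j := b j / (2 * mu j * m j.+1).
Let w r n := bin_moment r n / m n ^+ r.

Let mu_ge n : delta <= mu n.
Proof. by have /andP[h1 h2] := q_bounds n I0; exact: le_trans h2. Qed.

Let mu_gt0 n : 0 < mu n. Proof. exact: lt_le_trans (mu_ge n). Qed.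

Let bin2E n : nat_mean (X n) (fun i => 'C(i, 2)%:R) = b n / 2.
Proof.
have half : 0 <= 2^-1 :> R by rewrite invr_ge0.
rewrite mulrC -(nat_summableZ half (summable_fact2 (X_third n))).2.
congr nat_mean; apply/funext => k.
suff <- : 2 * 'C(k, 2)%:R = k%:R * (k%:R - 1) :> R.
  by rewrite mulrA mulVf ?mul1r// pnatr_eq0.
rewrite -natrM bin2 -[X in (X * _)%N]/2%N mul2n.
case: k => [|k]; first by rewrite mul0r.
rewrite -[X in _ = _ * (X - 1)]natr1 addrK -natrM; congr (_%:R).
by rewrite -[RHS]odd_double_half oddM /= andNb.
Qed.

Let bin_coef_top s n : bin_coef s.+2 n s.+2 s.+2 = mu n ^+ s.+2.
Proof.
rewrite /bin_coef subnn coef0_exp coef_poly /=; congr (_ ^+ _).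
by congr nat_mean; apply/funext => k; rewrite bin1.
Qed.

Let bin_coef_next s n : bin_coef s.+2 n s.+1 s.+2 = s.+1%:R * mu n ^+ s * (b n / 2).
Proof.
rewrite /bin_coef subSnn coef1_exp !coef_poly /= bin2E; congr (_ * _ ^+ _ * _).
by congr nat_mean; apply/funext => k; rewrite bin1.
Qed.

Let bin_coef0 s n : bin_coef s.+2 n 0 s.+2 = 0.
Proof. by rewrite /bin_coef expr0 coef1. Qed.

Let bound s l := ((\poly_(k < s.+2) K k.+1) ^+ l)`_(s.+2 - l).

Let bin_coef_bound s n l : 0 <= bin_coef s.+2 n l s.+2 <= bound s l.
Proof.
apply: coef_exp_bounds => k; rewrite !coef_poly; case: ifP => // _; last by rewrite lexx.
by rewrite X_binK nat_mean_ge0.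
Qed.

Let bound_ge0 s l : 0 <= bound s l.
Proof. by have /andP[h] := bin_coef_bound s 0 l; exact: le_trans. Qed.

(** After normalization the coefficient mu^(s+2) of the top term becomes 1, the next term is exactly
    (s + 1) gamma w_(s+1), and the term l = 0 vanishes. The others are nonnegative, with
    coefficients bounded uniformly in n; mu_n >= delta handles the normalization. *)
Let w_rec s n : `|w s.+2 n.+1 - w s.+2 n - s.+1%:R * gamma n * w s.+1 n| <=
  ((\sum_(l < s.+1) bound s l) / delta ^+ s.+2) *
    \sum_(1 <= l < s.+1) w l n * (m n)^-1 ^+ (s.+2 - l).
Proof.
have mn0 := mean_generation_gt0 n; have mun0 := mu_gt0 n.
have N_bin n' k : (k <= s.+2)%N -> nat_summable (X n') (fun i => 'C(i, k)%:R) by [].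
have -> : w s.+2 n.+1 - w s.+2 n - s.+1%:R * gamma n * w s.+1 n =
    \sum_(1 <= l < s.+1) bin_coef s.+2 n l s.+2 * bin_moment l n / (m n * mu n) ^+ s.+2.
  rewrite /w (bin_momentS N_bin)// 2!big_ord_recr/= bin_coef_top bin_coef_next.
  rewrite -(big_mkord xpredT (fun l => bin_coef s.+2 n l s.+2 * bin_moment l n)).
  rewrite big_ltn// bin_coef0 mul0r add0r -mulr_suml mean_generationS /gamma mean_generationS.
  set Sm := \sum_(1 <= l < s.+1) _.
  have e1 : (m n * mu n) ^+ s.+2 = m n ^+ s * mu n ^+ s * (m n * mu n) ^+ 2.
    by rewrite -exprMn -exprD addn2.
  rewrite e1 -[s.+2]addn2 -[s.+1]addn1 !exprD.
  set ms := m n ^+ s; set mus := mu n ^+ s.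
  have ms0 : ms != 0 by rewrite gt_eqF// exprn_gt0.
  have mus0 : mus != 0 by rewrite gt_eqF// exprn_gt0.
  by field; rewrite ms0 mus0 !gt_eqF.
rewrite ger0_norm; last first.
  apply: sumr_ge0 => l _; rewrite !mulr_ge0 ?bin_moment_ge0//.
    by have /andP[] := bin_coef_bound s n l.
  by rewrite invr_ge0 exprn_ge0// mulr_ge0 ?(ltW mn0) ?(ltW mun0).
rewrite mulr_sumr big_nat [leRHS]big_nat; apply: ler_sum => l /andP[l1 ls].
have -> : bin_coef s.+2 n l s.+2 * bin_moment l n / (m n * mu n) ^+ s.+2 =
    (bin_coef s.+2 n l s.+2 / mu n ^+ s.+2) * (w l n * (m n)^-1 ^+ (s.+2 - l)).
  have e : m n ^+ s.+2 = m n ^+ l * m n ^+ (s.+2 - l).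
    by rewrite -exprD subnKC// leqW// ltnW.
  rewrite /w exprMn exprVn e; set ml := m n ^+ l; set mr := m n ^+ (s.+2 - l).
  have ml0 : ml != 0 by rewrite gt_eqF// exprn_gt0.
  have mr0 : mr != 0 by rewrite gt_eqF// exprn_gt0.
  by field; rewrite mr0 ml0 gt_eqF// exprn_gt0.
apply: ler_wpM2r.
  rewrite mulr_ge0 ?exprn_ge0 ?invr_ge0 ?(ltW mn0)//.
  by rewrite divr_ge0 ?bin_moment_ge0// exprn_ge0// ltW.
have /andP[bc0 bcle] := bin_coef_bound s n l.
apply: ler_pM => //; first by rewrite invr_ge0 exprn_ge0// ltW.
  apply: le_trans bcle _; rewrite (bigD1 (Ordinal ls))//= lerDl.
  by apply: sumr_ge0 => i _.
by rewrite lef_pV2 ?posrE ?exprn_gt0// lerXn2r ?nnegrE ?(ltW mun0) ?(ltW delta_gt0).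
Qed.

Lemma bin_moment_asymptotics s : w s.+1 n / Gam n ^+ s @[n --> \oo] --> (1 : R).
Proof.
have M1 : 0 < M + 1 by exact: lt_le_trans (mu_le 0).
have gl j := gamma_lower delta_gt0 eps_gt0 mu_le q_bounds beta_b
  beta_eps mean_generation0 mean_generationS (j := j).
have gu := gamma_upper delta_gt0 mu_le q_bounds betaE beta_ge0 beta_b
  mean_generation0 mean_generationS.
apply: (moment_asymptotics (gamma := gamma) (a := fun n => (m n)^-1)
  (K := fun s => (\sum_(l < s.+1) bound s l) / delta ^+ s.+2) (c := eps / (M + 1) ^+ 2)).
- by move=> n; rewrite !GammaE big_ord_recr.
- exact: Gam_infty.
- by move=> n; rewrite invr_gt0 mean_generation_gt0.
- exact: inv_mean_small.
- by rewrite divr_gt0// exprn_gt0.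
- by exists N0 => // n /= Nn; exact: gl.
- have h : 2 * (M + 1) / delta ^+ 2 * ((m n)^-1 / Gam n) @[n --> \oo] -->
      (2 * (M + 1) / delta ^+ 2 * 0 : R).
    by apply: cvgM; [exact: cvg_cst|exact: inv_mean_small].
  rewrite mulr0 in h; apply: (squeeze_cvgr _ (cvg_cst 0) h); near=> n.
  have G0 : 0 < Gam n by near: n; exact: Gam_gt0.
  apply/andP; split.
    rewrite divr_ge0 ?(ltW G0)// /gamma divr_ge0//.
      exact/nat_mean_ge0/(summable_fact2 (X_third n)).
    by rewrite !mulr_ge0 ?(ltW (mu_gt0 _)) ?(ltW (mean_generation_gt0 _)).
  by rewrite mulrA ler_pM2r ?invr_gt0//; exact: gu.
- by move=> r n; rewrite divr_ge0 ?bin_moment_ge0// exprn_ge0// ltW// mean_generation_gt0.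
- by move=> n; rewrite /w expr1 -mean_generation divff// gt_eqF// mean_generation_gt0.
- by move=> r; rewrite divr_ge0 ?sumr_ge0// exprn_ge0// ltW.
- exact: w_rec.
Unshelve. all: by end_near. Qed.

(** The l-th term of the expansion is c_l D_l P(Z_n <> 0)^(r-1) / m_n^r. Since D_l / m_n^l is of
    order Gamma_n^(l-1), this behaves like c_l (m_n Gamma_n)^(l-r), so only l = r contributes, with
    c_r = r!. *)
Lemma zeta_moment_limit r : (0 < r)%N ->
  (\int[Pz n]_x (((zeta n x)%:R / cond_mean n) ^+ r)%:E)%E @[n --> \oo] --> (r`!%:R : R)%:E.
Proof.
case: r => // r _; have [c [cr cE]] := exp_binomial_basis r.
pose v n := \sum_(1 <= l < r.+2) (c l)%:R *
  ((w l n / Gam n ^+ l.-1) * ((survival_prob n * Gam n) ^+ r * ((m n)^-1 / Gam n) ^+ (r.+1 - l))).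
have v_lim : v n @[n --> \oo] --> (r.+1`!%:R : R).
  have -> : r.+1`!%:R = \sum_(1 <= l < r.+2) (c l)%:R * (1 * (1 ^+ r * 0 ^+ (r.+1 - l))) :> R.
    rewrite big_nat_recr//= subnn expr0 expr1n !mulr1 cr big_nat big1 ?add0r// => l /andP[_ lr].
    by rewrite expr0n subn_eq0 leqNgt lr !mulr0.
  rewrite /v big_nat; under eq_fun do rewrite big_nat.
  apply: (cvgr_sum (f := fun l n => (c l)%:R *
    ((w l n / Gam n ^+ l.-1) *
      ((survival_prob n * Gam n) ^+ r * ((m n)^-1 / Gam n) ^+ (r.+1 - l))))).
  move=> -[//|l] _ /=; apply: cvgM; first exact: cvg_cst.
  apply: cvgM; first exact: bin_moment_asymptotics.
  by apply: cvgM; apply: cvgr_exp; [exact: survival_Gamma|exact: inv_mean_small].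
have E n : (\int[Pz n]_x (((zeta n x)%:R / cond_mean n) ^+ r.+1)%:E)%E =
    ((\sum_(1 <= l < r.+2) (c l)%:R * bin_moment l n) * (survival_prob n ^+ r / m n ^+ r.+1))%:E.
  pose h k : R := (k%:R / cond_mean n) ^+ r.+1.
  have hE k : h k = \sum_(1 <= l < r.+2) ((c l)%:R / cond_mean n ^+ r.+1) * 'C(k, l)%:R.
    rewrite /h expr_div_n -natrX cE natr_sum mulr_suml; apply: eq_bigr => l _.
    by rewrite natrM mulrAC.
  have c0 l : 0 <= (c l)%:R / cond_mean n ^+ r.+1.
    by rewrite divr_ge0// exprn_ge0// ltW// cond_mean_gt0.
  have mC l : measurable_fun [set: T] (fun w => ('C(Z n w, l)%:R : R)%:E).
    exact: (measurable_EFin_nat (fun k => 'C(k, l)%:R) (measurable_branching xi_indep n)).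
  rewrite (integral_zeta n (h := h)); last 2 first.
  - by move=> k; rewrite /h exprn_ge0// divr_ge0// ltW// cond_mean_gt0.
  - by rewrite /h mul0r expr0n.
  have -> : (\int[P]_w (h (Z n w))%:E =
      (\sum_(1 <= l < r.+2) ((c l)%:R / cond_mean n ^+ r.+1) * bin_moment l n)%:E)%E.
    transitivity (\int[P]_w (\sum_(1 <= l < r.+2)
        (((c l)%:R / cond_mean n ^+ r.+1)%R%:E * ('C(Z n w, l)%:R%R)%:E)))%E.
      apply: eq_integral => x _; rewrite hE -sumEFin; apply: eq_bigr => l _.
      by rewrite EFinM.
    rewrite ge0_integral_sum//; last 2 first.
    - move=> l; apply/measurable_EFinP; apply: measurable_funM => //.
      by apply/measurable_EFinP; exact: mC.
    - by move=> l x _; rewrite mule_ge0// lee_fin.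
    rewrite -sumEFin; apply: eq_bigr => l _.
    by rewrite ge0_integralZl_EFin// EFinM (integral_bin (N := l)).
  rewrite -EFinM; congr (_%:E); rewrite mulr_suml mulr_sumr; apply: eq_bigr => l _.
  rewrite /cond_mean expr_div_n invf_div [in LHS]exprS.
  have p0 := survival_gt0 n; have mr : m n ^+ r.+1 != 0.
    by rewrite gt_eqF// exprn_gt0// mean_generation_gt0.
  by field; rewrite mr gt_eqF.
apply: cvg_EFin; first by apply: nearW => n; rewrite E.
apply: near_cvg v_lim; near=> n; rewrite /= E /=.
have G0 : 0 < Gam n by near: n; exact: Gam_gt0.
rewrite /v mulr_suml big_nat [RHS]big_nat; apply: eq_bigr => -[//|l] /= lr.
have lr' : (l <= r)%N by rewrite -2!ltnS.
have mn0 := mean_generation_gt0 n.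
have -> : (r.+1 - l.+1 = r - l)%N by [].
have -> : m n ^+ r.+1 = m n ^+ l.+1 * m n ^+ (r - l) by rewrite -exprD addSn subnKC.
rewrite /w exprMn !expr_div_n.
have -> : Gam n ^+ r = Gam n ^+ l * Gam n ^+ (r - l) by rewrite -exprD subnKC.
rewrite exprVn.
set x := m n ^+ l.+1; set y := m n ^+ (r - l); set z := Gam n ^+ l; set t := Gam n ^+ (r - l).
have x0 : x != 0 by rewrite gt_eqF// exprn_gt0.
have y0 : y != 0 by rewrite gt_eqF// exprn_gt0.
have z0 : z != 0 by rewrite gt_eqF// exprn_gt0.
have t0 : t != 0 by rewrite gt_eqF// exprn_gt0.
by field; rewrite x0 y0 z0 t0.
Unshelve. all: by end_near. Qed.

End all_moments.

End conditioned.

End survival.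

End process.

(** * The exponential distribution function and explicit constants *)

Lemma exponential_prob_le (R : realType) (x : R) :
  exponential_prob 1 `]-oo, x]%classic = (if 0 <= x then 1 - expR (- x) else 0)%:E.
Proof.
rewrite /exponential_prob.
have pdfE y : (exponential_pdf 1 y)%:E =
    ((fun y => (exponential_pdf 1 y)%:E) \_ `[0%R, +oo[%classic) y :> \bar R.
  rewrite /patch; case: ifPn => //; rewrite notin_setE/= in_itv/= andbT => /negP.
  by rewrite -ltNge => y0; rewrite lt0_exponential_pdf.
under eq_integral do rewrite pdfE.
rewrite -integral_mkcondr.
have -> : `]-oo, x]%classic `&` `[0%R, +oo[%classic = `[0%R, x]%classic :> set R.
  apply/seteqP; split => y /=; rewrite !in_itv/= ?andbT; first by case=> -> ->.
  by case/andP=> -> ->.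
have [x0|x0] := leP 0 x; last by rewrite set_itv_ge ?integral_set0// bnd_simp -ltNge.
have [->|x_neq0] := eqVneq x 0.
  by rewrite set_itv1 integral_set1 oppr0 expR0 subrr.
have x_gt0 : 0 < x by rewrite lt_neqAle eq_sym x_neq0.
have := exponential_prob_itv0c 1 x_gt0; rewrite /exponential_prob => ->.
by rewrite mulN1r EFinB.
Qed.

Lemma ereal_sup_lt1P (R : realType) (f : nat -> \bar R) : (forall n, 0 <= f n)%E ->
  (ereal_sup (range f) < 1)%E ->
  exists2 delta : R, 0 < delta & forall n, (f n <= (1 - delta)%:E)%E.
Proof.
move=> f0 f1.
have le n : (f n <= ereal_sup (range f))%E by apply: ereal_sup_ubound; exists n.
have fin : ereal_sup (range f) \is a fin_num.
  rewrite ge0_fin_numE; first exact: lt_trans f1 (ltry _).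
  exact: le_trans (f0 0%N) (le 0%N).
exists (1 - fine (ereal_sup (range f))).
  by rewrite subr_gt0 -lte_fin fineK.
by move=> n; rewrite subKr fineK.
Qed.

(** The limit superior is an infimum of suprema over neighbourhoods of infinity, so one of these
    suprema is already below 1; its distance to 1 is eps. *)
Lemma limn_esup_lt1 (R : realType) (f : nat -> \bar R) : (forall n, 0 <= f n)%E ->
  (limn_esup f < 1)%E ->
  exists2 eps : R, 0 < eps &
    exists N0, forall n, (N0 <= n)%N -> (f n <= (1 - eps)%:E)%E.
Proof.
move=> f0 /ereal_inf_lt[_ [A /= [N0 _ NA] <-]] fA1.
have le n : (N0 <= n)%N -> (f n <= ereal_sup (f @` A))%E.
  by move=> Nn; apply: ereal_sup_ubound; exists n => //; exact: NA.
have fin : ereal_sup (f @` A) \is a fin_num.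
  rewrite ge0_fin_numE; first exact: lt_trans fA1 (ltry _).
  exact: le_trans (f0 N0) (le _ (leqnn _)).
exists (1 - fine (ereal_sup (f @` A))).
  by rewrite subr_gt0 -lte_fin fineK.
by exists N0 => n Nn; rewrite subKr fineK// le.
Qed.

Lemma moment_bounded (R : realType) (d0 : measure_display) (T0 : measurableType d0)
    (P0 : probability T0 R) (X : nat -> {RV P0 >-> nat}) (r : nat) :
  (ereal_sup (range (fun n => moment P0 (fun w => (X n w)%:R%R) r)) < +oo)%E ->
  exists K : R, forall n, (\int[P0]_w ((X n w)%:R ^+ r)%:E <= K%:E)%E.
Proof.
set s := ereal_sup _ => soo.
have le n : (\int[P0]_w ((X n w)%:R ^+ r)%:E <= s)%E.
  by apply: ereal_sup_ubound; exists n => //; rewrite /moment unlock.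
have s0 : (0 <= s)%E.
  by apply: le_trans (le 0%N); apply: integral_ge0 => w _; rewrite lee_fin exprn_ge0.
by exists (fine s) => n; rewrite fineK// ge0_fin_numE.
Qed.

Lemma bin_le_exp k r : ('C(k, r) <= k ^ r)%N.
Proof.
apply: leq_trans (_ : k ^_ r <= _)%N.
  by rewrite -bin_ffact leq_pmulr// fact_gt0.
elim: r k => [|r IH] k; first by rewrite ffactn0.
by rewrite ffactnSr expnSr leq_mul ?leq_subr.
Qed.

Local Open Scope ereal_scope.

Theorem theorem1 (R : realType)
  (* the offspring variables X_n *)
  (d0 : measure_display) (T0 : measurableType d0) (P0 : probability T0 R)
  (X : nat -> {RV P0 >-> nat})
  (* the independent copies X_{n,j} and the process Z_n *)
  (d : measure_display) (T : measurableType d) (P : probability T R)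
  (xi : nat -> nat -> {RV P >-> nat})
  (xi_indep : mutually_independent (fun nj : nat * nat => xi nj.1 nj.2))
  (xi_law : forall n j : nat, same_distribution (xi n j) (X n))
  (Z : nat -> T -> nat)
  (Z_def : Z = branching xi)
  (m : nat -> R)
  (m_def : forall n, m n = mean_nat P (Z n))
  (* zeta_n : Z_n conditioned on non-extinction *)
  (dz : nat -> measure_display) (Tz : forall n, measurableType (dz n))
  (Pz : forall n, probability (Tz n) R)
  (zeta : forall n, {RV (Pz n) >-> nat})
  (zeta_law : forall (n : nat) (A : set nat),
     distribution (Pz n) (zeta n) A =
     cond_prob P (Z n @^-1` A) [set w | Z n w <> 0%N])
  (* (i) *)
  (hi : ereal_sup (range (fun n => P0 [set w | X n w = 0%N])) < 1)
  (* (ii) *)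
  (hii : limn_esup (fun n => P0 [set w | X n w = 0%N] +
                             P0 [set w | X n w = 1%N]) < 1)
  (* (iii) *)
  (hiii : 0 < limn_einf (fun n => P0 [set w | X n w = 0%N]))
  (* (iv) *)
  (hiv : Gamma P0 X m n @[n --> \oo] --> +oo%R)
  (* (v) *)
  (hv : (m n * Gamma P0 X m n)%R @[n --> \oo] --> +oo%R) :
  (* (a) *)
  ((forall r : nat, (1 <= r <= 3)%N ->
      ereal_sup (range (fun n => moment P0 (fun w => (X n w)%:R%R) r)) < +oo) ->
   cvg_in_distribution
     (fun n => scaled_rv (zeta n) (mean_nat (Pz n) (zeta n)))
     (exponential_prob 1%R)) /\
  (* (b) *)
  ((forall r : nat, (1 <= r)%N ->
      ereal_sup (range (fun n => moment P0 (fun w => (X n w)%:R%R) r)) < +oo) ->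
   forall r : nat, (1 <= r)%N ->
     moment (Pz n) (scaled_rv (zeta n) (mean_nat (Pz n) (zeta n))) r
       @[n --> \oo] --> (r`!%:R%R : R)%:E).
Proof.
have {m_def} Em : m = fun n => mean_nat P (Z n) by apply/funext.
subst m Z.
have P0_ge0 (n k : nat) : 0 <= P0 [set w | X n w = k] by [].
have [delta delta_gt0 X_eq0] := ereal_sup_lt1P (fun n => P0_ge0 n 0%N) hi.
have [eps eps_gt0 [N0 X_le1]] :=
  limn_esup_lt1 (fun n => adde_ge0 (P0_ge0 n 0%N) (P0_ge0 n 1%N)) hii.
split.
- move=> hmom; have [M X_third] := moment_bounded (hmom 3%N isT).
  have meanE n := mean_zeta xi_indep xi_law X_third delta_gt0 X_eq0 zeta_law n.
  have lim x := exponential_limit xi_indep xi_law X_third delta_gt0 X_eq0 eps_gt0 X_le1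
    hiv hv zeta_law (x := x).
  move=> x _; rewrite exponential_prob_le; case: leP => x0.
    have -> : (fun n => cdf (scaled_rv (zeta n) (mean_nat (Pz n) (zeta n))) x) =
        (fun n => Pz n [set w | (zeta n w)%:R / cond_mean xi n <= x]%R).
      apply/funext => n; rewrite /cdf /distribution /pushforward meanE.
      by congr (Pz n _); apply/seteqP; split => w /=; rewrite in_itv.
    exact: lim.
  rewrite (_ : (fun n => _) = cst 0%E); first exact: cvg_cst.
  apply/funext => n; rewrite /cdf /distribution /pushforward meanE.
  rewrite (_ : _ @^-1` _ = set0) ?measure0//; apply/seteqP; split => w //=.
  rewrite in_itv/= => /le_lt_trans/(_ x0); rewrite ltNge => /negP; apply.
  rewrite divr_ge0//; apply/ltW.
  exact: (cond_mean_gt0 xi_indep xi_law X_third delta_gt0 X_eq0).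
move=> hmom r r_gt0.
have [M X_third] := moment_bounded (hmom 3%N isT).
have meanE n := mean_zeta xi_indep xi_law X_third delta_gt0 X_eq0 zeta_law n.
have /choice[K KP] : forall k, exists K : R, forall n,
    nat_summable (X n) (fun i => 'C(i, k)%:R%R) /\
    (nat_mean (X n) (fun i => 'C(i, k)%:R) <= K)%R.
  (* The moment hypotheses start at r = 1; the binomial moment of order 0 is the constant 1. *)
  case=> [|k].
    exists 1%R => n; under eq_fun do rewrite bin0.
    by have [h1 h2] := nat_summable_cst (X n) ler01; rewrite h2.
  have [K HK] := moment_bounded (hmom k.+1 isT).
  exists K => n.
  have sp : nat_summable (X n) (fun i => i%:R ^+ k.+1)%R.
    by split; [move=> i; rewrite exprn_ge0|exact: le_lt_trans (HK n) (ltry _)].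
  have le i : (0 <= ('C(i, k.+1)%:R : R) <= i%:R ^+ k.+1)%R.
    by rewrite ler0n -natrX ler_nat bin_le_exp.
  have [h1 h2] := nat_summable_le le sp; split=> //.
  by rewrite (le_trans h2)// -lee_fin -nat_meanE.
have lim := zeta_moment_limit xi_indep xi_law X_third delta_gt0 X_eq0 eps_gt0 X_le1
  hiv hv zeta_law (fun n k => (KP k n).1)
  (fun n k => (KP k n).2) r_gt0.
rewrite (_ : (fun n => _) =
  (fun n => \int[Pz n]_w (((zeta n w)%:R / cond_mean xi n) ^+ r)%:E))//.
by apply/funext => n; rewrite /moment unlock meanE.
Qed.
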